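(* The Lie algebra $\mathcal{L}_{\widehat{\mathcal{C}}_f}:=\log(\widehat{\mathcal{C}}_f)\subset\mathcal{L}_{Lie}$ of the group of formal centers $\widehat{\mathcal{C}}_f$ consists of the elements $$\sum_{n=1}^{\infty}\Big(\sum_{i_1+\cdots+i_k=n}c_{i_1,\dots,i_k}[X_{i_1},[X_{i_2},[\cdots,[X_{i_{k-1}},X_{i_k}]\cdots]]]\Big)t^n\in\mathcal{L}_{Lie}$$ such that $$\sum_{i_1+\cdots+i_k=n}c_{i_1,\dots,i_k}\cdot\gamma_{i_1,\dots,i_k}=0\quad\text{for all }n\in\mathbb{N},$$ where $\gamma_n=1$ and, for $k\ge2$, $$\gamma_{i_1,\dots,i_k}=(i_{k-1}-i_k)(i_{k-2}-i_{k-1}-i_k)\cdots(i_1-i_2-\cdots-i_k).$$ In particular, the map $\exp:\mathcal{L}_{\widehat{\mathcal{C}}_f}\to\widehat{\mathcal{C}}_f$ is a homeomorphism.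
   Context: Algebra. Let $\mathbb{C}\langle X_1,X_2,\dots\rangle$ be the associative algebra with unit $I$ of complex noncommutative polynomials in free noncommuting variables $X_1,X_2,\dots$. Let $\mathcal{A}\subset\mathbb{C}\langle X_1,X_2,\dots\rangle[[t]]$ be the subalgebra of formal power series of the form $f=c_0I+\sum_{n\ge1}\big(\sum_{i_1+\cdots+i_k=n}c_{i_1,\dots,i_k}X_{i_1}\cdots X_{i_k}\big)t^n$ with complex coefficients (inner sums here and in the claim are over all $k\ge1$ and all $(i_1,\dots,i_k)\in\mathbb{N}^k$ with sum $n$; for $k=1$ the bracket term is $X_n$). Equip $\mathcal{A}$ with the weakest topology making all coefficient functions continuous. Let $G\subset\mathcal{A}$ be the topological group (under multiplication) of elements with $c_0=1$, and $\mathcal{L}_G\subset\mathcal{A}$ the Lie algebra of elements with $c_0=0$, with $[f,g]=fg-gf$. The map $\exp:\mathcal{L}_G\to G$, $\exp(f)=\sum_{n\ge0}f^n/n!$, is a homeomorphism with inverse $\log$. $\mathcal{L}_{Lie}\subset\mathcal{L}_G$ is the set of Lie elements, i.e. of $g=\sum_{n\ge1}g_nt^n\in\mathcal{L}_G$ with each $g_n$ in the free Lie algebra generated by $X_1,\dots,X_n$; equivalently each $g_n$ can be written (not uniquely) as $\sum_{i_1+\cdots+i_k=n}c_{i_1,\dots,i_k}[X_{i_1},[\cdots,[X_{i_{k-1}},X_{i_k}]\cdots]]$ with $c_{i_1,\dots,i_k}\in\mathbb{C}$. Paths. Fix $T>0$, $I_T=[0,T]$. $X$ is the set of sequences $a=(a_1,a_2,\dots)$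 of complex-valued functions $a_i\in L^\infty(I_T)$ with $\sup_{x\in I_T,\,i\in\mathbb{N}}|a_i(x)|^{1/i}<\infty$. For $a\in X$ let $F_a:I_T\to G$ be the solution (by Picard iteration, with coefficients Lipschitz in $x$) of $F'(x)=\big(\sum_{i\ge1}a_i(x)t^iX_i\big)F(x)$, $F_a(0)=I$, and set $E(a)=F_a(T)\in G$. $G(X):=E(X)$ is a subgroup of $G$, and the group of formal paths $G_f(X)$ is its closure in $G$ (the paper defines these as a quotient of $X$ and its completion and identifies them with these subgroups). One has $G_f(X)\subset\exp(\mathcal{L}_{Lie})$. Formal centers. For $a\in X$ let $I_{i_1,\dots,i_k}(a)=\int\cdots\int_{0\le s_1\le\cdots\le s_k\le T}a_{i_k}(s_k)\cdots a_{i_1}(s_1)\,ds_k\cdots ds_1$, and let $\widehat I_{i_1,\dots,i_k}$ be the unique continuous function on $G_f(X)$ with $\widehat I_{i_1,\dots,i_k}(E(a))=I_{i_1,\dots,i_k}(a)$, $a\in X$. Let $p_{i_1,\dots,i_k}(t)=(t-i_1+1)(t-i_1-i_2+1)\cdots(t-i_1-\cdots-i_k+1)$. Let $G[[r]]$ be the group of formal complex power series $r+\sum_{i\ge1}d_ir^{i+1}$ under composition. The map $\widehat P:G_f(X)\to G[[r]]$, $$\widehat P(g)=r+\sum_{i=1}^{\infty}\Big(\sum_{i_1+\cdots+i_k=i}p_{i_1,\dots,i_k}(i)\,\widehat I_{i_1,\dots,i_k}(g)\Big)r^{i+1},$$ is a group homomorphism; $\widehat{\mathcal{C}}_f:=\ker\widehat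 P$ is the group of formal centers of the equation $v'=\sum_{i\ge1}a_i(x)v^{i+1}$. *)

(* Defs.v *)
From HB Require Import structures.
From mathcomp Require Import all_boot all_order all_algebra.
From mathcomp Require Import all_classical all_reals all_analysis.
From mathcomp.real_closed Require Import complex.

Set Implicit Arguments.
Unset Strict Implicit.
Unset Printing Implicit Defensive.

Import Order.TTheory GRing.Theory Num.Theory.
Import numFieldNormedType.Exports.
Import ComplexField.Normc.

Local Open Scope classical_set_scope.
Local Open Scope ring_scope.
Local Open Scope complex_scope.

(* The indices of the variables X_1, X_2, ... start at 1. *)
Definition posnat : Type := {n : nat | (0 < n)%N}.
HB.instance Definition _ := Countable.on posnat.
Coercion nat_of_posnat (i : posnat) : nat := val i.

(* [:: i_1; ...; i_k] stands for the monomial X_{i_1} ... X_{i_k}, and also for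
   a multi-index (i_1, ..., i_k). *)
Notation word := (seq posnat).

Definition weight (w : word) : nat := (\sum_(i <- w) (i : nat))%N.

(* The power of t attached to the monomial w is its weight, so that an element
   of the algebra is given by an arbitrary family of coefficients c_w; the
   coefficient of t^n is a finite sum as finitely many words have weight n. *)
Definition ncseries (R : rcfType) : Type := word -> R[i].

Section SeriesRing.
Variable R : rcfType.
Implicit Types f g h : ncseries R.

HB.instance Definition _ := GRing.Lmodule.copy (ncseries R) (word -> (R[i])^o).

Definition ncseries_one : ncseries R := fun w => (w == [::])%:R.

Definition ncseries_mul f g : ncseries R :=
  fun w => \sum_(0 <= k < (size w).+1) f (take k w) * g (drop k w).

Fact ncseries_mulA : associative ncseries_mul.
Proof.
move=> f g h; apply/funext => w; rewrite /ncseries_mul.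
pose F i m : R[i] := f (take i w) * (g (take (m - i) (drop i w)) * h (drop m w)).
transitivity (\sum_(0 <= i < (size w).+1) \sum_(0 <= m < (size w).+1 | (i <= m)%N)
   F i m).
  apply: eq_big_nat => i /andP[_ ltiw].
  rewrite mulr_sumr -(@big_nat_widenl _ _ _ i 0 (size w).+1 xpredT)//=.
  have := big_addn 0 (size w).+1 i xpredT (F i); rewrite add0n => ->.
  rewrite size_drop subSn//.
  by apply: eq_bigr => j _; rewrite /F addnK drop_drop.
rewrite (exchange_big_dep_nat xpredT)//=.
rewrite big_nat_cond [RHS]big_nat_cond.
apply: eq_bigr => m /andP[/andP[_ ltmw] _].
rewrite mulr_suml size_takel// (big_nat_widen 0 m.+1 (size w).+1)//.
apply: eq_bigr => j lejm.
by rewrite /F -mulrA take_takel// take_drop subnK.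
Qed.

Fact ncseries_mul1 : left_id ncseries_one ncseries_mul.
Proof.
move=> f; apply/funext => w; rewrite /ncseries_mul big_nat_recl// take0 drop0.
rewrite mul1r big_nat_cond big1 ?addr0// => k /andP[/andP[_ ltkw] _].
by case: w ltkw => [//|i w] _; rewrite /ncseries_one mul0r.
Qed.

Fact ncseries_mulr1 : right_id ncseries_one ncseries_mul.
Proof.
move=> f; apply/funext => w; rewrite /ncseries_mul big_nat_recr//= take_size.
rewrite drop_size mulr1 big_nat_cond big1 ?add0r// => k /andP[/andP[_ ltkw] _].
by rewrite /ncseries_one -size_eq0 size_drop subn_eq0 leqNgt ltkw mulr0.
Qed.

Fact ncseries_mulDl : left_distributive ncseries_mul +%R.
Proof.
move=> f g h; apply/funext => w.
rewrite [RHS](_ : _ = ncseries_mul f h w + ncseries_mul g h w)// -big_split/=.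
by apply: eq_bigr => k _; rewrite -mulrDl.
Qed.

Fact ncseries_mulDr : right_distributive ncseries_mul +%R.
Proof.
move=> f g h; apply/funext => w.
rewrite [RHS](_ : _ = ncseries_mul f g w + ncseries_mul f h w)// -big_split/=.
by apply: eq_bigr => k _; rewrite -mulrDr.
Qed.

Fact ncseries_one_neq0 : ncseries_one != 0.
Proof.
by apply/eqP => /(congr1 (fun f => f [::]))/eqP; rewrite /ncseries_one oner_eq0.
Qed.

HB.instance Definition _ := GRing.Zmodule_isNzRing.Build (ncseries R)
  ncseries_mulA ncseries_mul1 ncseries_mulr1 ncseries_mulDl ncseries_mulDr ncseries_one_neq0.

Fact ncseries_scalerAl (c : R[i]) f g : c *: (f * g) = (c *: f) * g.
Proof.
apply/funext => w; rewrite [LHS]mulr_sumr.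
by apply: eq_bigr => k _; rewrite mulrA.
Qed.
HB.instance Definition _ :=
  GRing.Lmodule_isLalgebra.Build R[i] (ncseries R) ncseries_scalerAl.

Fact ncseries_scalerAr (c : R[i]) f g : c *: (f * g) = f * (c *: g).
Proof.
apply/funext => w; rewrite [LHS]mulr_sumr.
by apply: eq_bigr => k _; rewrite mulrCA.
Qed.
HB.instance Definition _ :=
  GRing.Lalgebra_isAlgebra.Build R[i] (ncseries R) ncseries_scalerAr.

End SeriesRing.

(* The weakest topology making all the coefficient functions continuous. *)
HB.instance Definition _ (R : realType) :=
  Uniform.copy (ncseries R) (prod_topology (fun _ : word => (R[i])^o)).
HB.instance Definition _ (R : realType) := isPointed.Build (ncseries R) 0.

Section LieElements.
Variable R : realType.
Implicit Types (f g : ncseries R) (c : word -> R[i]).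

Definition group_G : set (ncseries R) := [set f | f [::] = 1].

Definition lie_G : set (ncseries R) := [set f | f [::] = 0].

Definition nc_exp f : ncseries R :=
  \big[+%R/0]_(0 <= n <oo) ((n`!%:R : R[i])^-1 *: f ^+ n).

(* The inverse of nc_exp : lie_G -> group_G. *)
Definition nc_log : ncseries R -> ncseries R :=
  'pinv_(fun=> 0) lie_G nc_exp.

Definition bracket f g : ncseries R := f * g - g * f.

Definition lie_subalgebra (L : set (ncseries R)) : Prop :=
  [/\ L 0,
      forall f g, L f -> L g -> L (f + g),
      forall (a : R[i]) f, L f -> L (a *: f) &
      forall f g, L f -> L g -> L (bracket f g)].

(* The element X_i t^i. *)
Definition var (i : posnat) : ncseries R := fun w => (w == [:: i])%:R.

(* Noncommutative polynomials are seen as finitely supported families of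
   coefficients, i.e. P(X_1, X_2, ...) is identified with
   P(X_1 t, X_2 t^2, ...). *)
Definition free_lie (n : nat) : set (ncseries R) :=
  smallest lie_subalgebra [set f | exists2 i : posnat, (i <= n)%N & f = var i].

(* g_n t^n, where g = \sum_n g_n t^n. *)
Definition homogeneous_part (n : nat) g : ncseries R :=
  fun w => if weight w == n then g w else 0.

Definition lie_elements : set (ncseries R) :=
  [set g | lie_G g /\
           forall n, (0 < n)%N -> free_lie n (homogeneous_part n g)].

(* [X_{i_1}, [X_{i_2}, [..., [X_{i_{k-1}}, X_{i_k}]...]]] t^(i_1 + ... + i_k) *)
Fixpoint nested_bracket (w : word) : ncseries R :=
  match w with
  | [::] => 0
  | [:: i] => var i
  | i :: w' => bracket (var i) (nested_bracket w')
  end.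

Definition lie_series c : ncseries R :=
  \big[+%R/0]_(1 <= n <oo)
    \sum_(w \in [set w | weight w = n]) c w *: nested_bracket w.

End LieElements.

Fixpoint gamma (w : word) : int :=
  match w with
  | [::] | [:: _] => 1
  | i :: w' => ((i : nat)%:Z - (weight w')%:Z) * gamma w'
  end.

Section Paths.
Variables (R : realType) (T : R).
Local Notation mu := (@lebesgue_measure R).
Implicit Types (a : posnat -> R -> R[i]) (F : R -> ncseries R)
  (g : ncseries R).

Definition Linfty (f : R -> R[i]) : Prop :=
  [/\ measurable_fun `[0, T] (fun x => complex.Re (f x)),
      measurable_fun `[0, T] (fun x => complex.Im (f x)) &
      exists M : R, {ae mu, forall x, x \in `[0, T] -> normc (f x) <= M}].

(* As elements of L^oo are classes modulo a.e. equality, the supremum over x is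
   an essential one. *)
Definition path_space : set (posnat -> R -> R[i]) :=
  [set a | (forall i, Linfty (a i)) /\
    exists M : R, {ae mu, forall x, x \in `[0, T] ->
      forall i : posnat, normc (a i x) `^ (i%:R)^-1 <= M}].

(* \sum_(i >= 1) a_i(x) t^i X_i *)
Definition path_symbol a (x : R) : ncseries R :=
  fun w => if w is [:: i] then a i x else 0.

(* With coefficients a_i in L^oo the differential equation holds at almost every
   x; only the restriction of F to [0, T] matters. *)
Definition path_solution a F : Prop :=
  [/\ forall x, x \in `[0, T] -> group_G (F x),
      F 0 = 1,
      forall w, exists K : R, forall x y, x \in `[0, T] -> y \in `[0, T] ->
        normc (F x w - F y w) <= K * `|x - y| &
      {ae mu, forall x, x \in `]0, T[ -> forall w,
        is_derive x 1 (fun s => complex.Re (F s w))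
          (complex.Re ((path_symbol a x * F x) w)) /\
        is_derive x 1 (fun s => complex.Im (F s w))
          (complex.Im ((path_symbol a x * F x) w))}].

Definition endpoint a : ncseries R :=
  xget (fun=> 1) [set F | path_solution a F] T.

(* The closure is taken in group_G. *)
Definition formal_paths : set (ncseries R) :=
  closure (endpoint @` path_space) `&` @group_G R.

Definition cintegral (A : set R) (f : R -> R[i]) : R[i] :=
  (\int[mu]_(s in A) complex.Re (f s)) +i* (\int[mu]_(s in A) complex.Im (f s)).

(* The integral over x <= s_1 <= ... <= s_k <= T, with s_k innermost. *)
Fixpoint iterated_integral_from a (w : word) (x : R) : R[i] :=
  match w with
  | [::] => 1
  | i :: w' =>
      cintegral `[x, T] (fun s => a i s * iterated_integral_from a w' s)
  end.

Definition iterated_integral a (w : word) : R[i] :=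
  iterated_integral_from a w 0.

(* Only the values on formal_paths are meaningful. *)
Definition Ihat (w : word) : ncseries R -> (R[i])^o :=
  xget (fun=> 0)
    [set J : ncseries R -> (R[i])^o |
      {within formal_paths, continuous J} /\
      forall a, path_space a -> J (endpoint a) = iterated_integral a w].

Definition center_poly (w : word) : {poly R[i]} :=
  \prod_(1 <= j < (size w).+1) ('X - (weight (take j w))%:R%:P + 1).

(* Formal power series in r are given by their coefficients. *)
Definition Phat g : nat -> R[i] := fun n =>
  match n with
  | 0%N => 0
  | 1%N => 1
  | i.+1 => \sum_(w \in [set w | weight w = i])
              (center_poly w).[i%:R] * Ihat w g
  end.

(* The kernel of Phat: the identity of the group of formal power series under
   composition is the series r. *)
Definition formal_centers : set (ncseries R) :=
  formal_paths `&` [set g | Phat g = fun n => (n == 1)%:R].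

End Paths.

Definition homeomorphism_between (U V : topologicalType) (A : set U)
    (B : set V) (f : U -> V) : Prop :=
  [/\ set_bij A B f,
      {within A, continuous f} &
      exists g : V -> U, {in A, cancel f g} /\ {within B, continuous g}].

(* Main.v *)
Require Import Defs.
From mathcomp Require Import all_boot all_order all_algebra.
From mathcomp Require Import all_classical all_reals all_analysis measurable_realfun.
From mathcomp Require Import ring lra.
From mathcomp.real_closed Require Import complex.
Import Order.TTheory GRing.Theory Num.Theory.
Import numFieldNormedType.Exports.
Set Implicit Arguments.
Unset Strict Implicit.
Unset Printing Implicit Defensive.
Local Open Scope classical_set_scope.
Local Open Scope ring_scope.

(** Call a series g with constant term 1 group-like when N g = D(g) g, where N is
    the degree derivation t d/dt and D the Dynkin operator, sending a word w to
    the bracket [X_{i_1}, [..., X_{i_k}]] times the degree of its last letter.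
    This quadratic equation is preserved by limits, holds for exp(f) when f is
    Lie (by the Dynkin-Specht-Wever property), and holds along F' = A F because
    N F - D(F) F solves the same linear equation with initial value 0.  If two
    group-like series first differ in degree n, their difference q there satisfies
    n q = D(q), hence is a Lie polynomial.  It follows that group-like series are
    the exponentials of Lie elements; and since commutators of the exp(c X_i),
    which are reached by piecewise constant paths, realise all brackets to lowest
    order, the group of formal paths is the group of all group-like series.

    Letting X_i act by r^(i+1) d/dr, the map Phat sends g to the image of r under
    g.  As [r^(i+1) d/dr, r^(j+1) d/dr] = (j - i) r^(i+j+1) d/dr, a Lie element
    acts by a vector field whose coefficients are the sums of c_w gamma_w, and
    its exponential fixes r exactly when this vector field vanishes. *)

(** * Degree filtration and Dynkin operator *)

(** The equation N g = D(g) g says that D(g) is the logarithmic derivative of g along N. It plays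
    the role of the shuffle relations while staying inside a single algebra, and at each word it
    involves finitely many coefficients, so it passes to coefficientwise limits. Weighting by the
    degree of the last letter makes D agree with N on Lie elements, so that division by n recovers
    the degree-n part as a combination of nested brackets.

    Two points shape the analysis. The coefficients of a path are merely bounded and measurable, so
    uniqueness for F' = A F rests on the fact that a Lipschitz function with derivative 0 almost
    everywhere is constant, applied one coefficient at a time: A is linear in the letters, which
    makes the system triangular in the length of words. And F' = A F puts the latest letter on the
    left, whereas iterated integrals list letters in order of time; hence the reversed words
    wherever [Ihat] and [Phat] are evaluated. *)

Section Algebra.
Variable R : realType.
Implicit Types (f g h A : ncseries R) (u v w : word) (i j : posnat) (c : R[i]).

Lemma ncD f g w : (f + g) w = f w + g w. Proof. by []. Qed.
Lemma ncN f w : (- f) w = - f w. Proof. by []. Qed.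
Lemma ncB f g w : (f - g) w = f w - g w. Proof. by []. Qed.
Lemma ncZ c f w : (c *: f) w = c * f w. Proof. by []. Qed.
Lemma nc0 w : (0 : ncseries R) w = 0. Proof. by []. Qed.
Lemma nc1 w : (1 : ncseries R) w = (w == [::])%:R. Proof. by []. Qed.
Lemma ncM f g w :
  (f * g) w = \sum_(0 <= k < (size w).+1) f (take k w) * g (drop k w).
Proof. by []. Qed.
Lemma nc_sum (I : Type) (r : seq I) (P : pred I) (F : I -> ncseries R) w :
  (\sum_(i <- r | P i) F i) w = \sum_(i <- r | P i) F i w.
Proof. by elim/big_rec2: _ => // i x y _ <-. Qed.

Lemma ncM_nil f g : (f * g) [::] = f [::] * g [::].
Proof. by rewrite ncM/= big_nat1. Qed.

Lemma ncX_nil f n : (f ^+ n) [::] = f [::] ^+ n.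
Proof. by elim: n => [|n IH]; rewrite ?expr0// !exprS ncM_nil IH. Qed.

Lemma weight_cons i w : weight (i :: w) = (i + weight w)%N.
Proof. by rewrite /weight big_cons. Qed.

Lemma weight_nil : weight [::] = 0%N.
Proof. by rewrite /weight big_nil. Qed.

Lemma weight_cat u v : weight (u ++ v) = (weight u + weight v)%N.
Proof. by rewrite /weight big_cat. Qed.

Lemma weight_rcons w i : weight (rcons w i) = (weight w + i)%N.
Proof. by rewrite -cats1 weight_cat weight_cons weight_nil addn0. Qed.

Lemma weight_rev w : weight (rev w) = weight w.
Proof. by elim: w => // i w IH; rewrite rev_cons weight_rcons IH weight_cons addnC. Qed.

Lemma posnat_gt0 i : (0 < i)%N.
Proof. exact: (valP i). Qed.

Lemma weight_eq0 w : (weight w == 0%N) = (w == [::]).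
Proof.
case: w => [|i w]; first by rewrite weight_nil.
by rewrite weight_cons addn_eq0 eqn0Ngt posnat_gt0.
Qed.

(** The statement f = O(t^k). Identities between series are proved modulo t^n for every n, where
    infinite sums become finite. *)
Definition vanish (k : nat) f := forall w, (weight w < k)%N -> f w = 0.

Lemma vanishW (m k : nat) f : (m <= k)%N -> vanish k f -> vanish m f.
Proof. by move=> jk fk w wj; apply: fk; apply: leq_trans jk. Qed.

Lemma vanishE f : vanish 1 f <-> f [::] = 0.
Proof.
split=> [f1|f0 w]; first by apply: f1; rewrite weight_nil.
by rewrite ltnS leqn0 weight_eq0 => /eqP->.
Qed.

Lemma vanish_nil f : f [::] = 0 -> vanish 1 f.
Proof. by move/vanishE. Qed.

Lemma vanish_any f : vanish 0 f. Proof. by []. Qed.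

Lemma vanishD k f g : vanish k f -> vanish k g -> vanish k (f + g).
Proof. by move=> fk gk w wk; rewrite ncD fk// gk// addr0. Qed.

Lemma vanishN k f : vanish k f -> vanish k (- f).
Proof. by move=> fk w wk; rewrite ncN fk// oppr0. Qed.

Lemma vanishB k f g : vanish k f -> vanish k g -> vanish k (f - g).
Proof. by move=> fk gk; apply/vanishD/vanishN. Qed.

Lemma vanishZ k c f : vanish k f -> vanish k (c *: f).
Proof. by move=> fk w wk; rewrite ncZ fk// mulr0. Qed.

Lemma vanishM (m k : nat) f g : vanish m f -> vanish k g -> vanish (m + k)%N (f * g).
Proof.
move=> fm gk w wjk; rewrite ncM big1_seq// => n _.
have [wj|jw] := ltnP (weight (take n w)) m; first by rewrite fm// mul0r.
rewrite gk ?mulr0//; move: wjk; rewrite -{1}(cat_take_drop n w) weight_cat.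
by move=> H; rewrite -(ltn_add2l m); apply: leq_ltn_trans H; rewrite leq_add2r.
Qed.

Lemma vanishMl k f g : vanish k f -> vanish k (f * g).
Proof. by move=> fk; rewrite -[k]addn0; exact: (vanishM fk (vanish_any g)). Qed.

Lemma vanishMr k f g : vanish k g -> vanish k (f * g).
Proof. by move=> gk; rewrite -[k]add0n; exact: (vanishM (vanish_any f) gk). Qed.

Lemma vanishX n f : f [::] = 0 -> vanish n (f ^+ n).
Proof.
move=> f0; elim: n => [|n IH] //; rewrite exprS -[n.+1]add1n.
by apply: (@vanishM 1) => //; apply/vanishE.
Qed.

(** Telescoping leaves, besides one factor f - g, n - 1 factors without constant term, each worth
    one degree. *)
Lemma vanish_subX n k f g : f [::] = 0 -> g [::] = 0 -> vanish k (f - g) ->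
  vanish (k + n.-1)%N (f ^+ n - g ^+ n).
Proof.
move=> f0 g0 fg; elim: n => [|n IH]; first by rewrite !expr0 subrr.
have -> : f ^+ n.+1 - g ^+ n.+1 = f * (f ^+ n - g ^+ n) + (f - g) * g ^+ n.
  by rewrite mulrBr mulrBl !exprS addrA subrK.
apply: vanishD; last by apply: (@vanishM k n) => //; apply: vanishX.
case: n IH => [|n] IH; first by rewrite !expr0 subrr mulr0.
by rewrite /= -add1n addnCA; apply: vanishM => //; apply/vanishE.
Qed.

(** Linear combinations of the X_i t^i. Multiplication by such a series on the left acts on
    coefficients through the first letter alone, on the right through the last. *)
Definition letters A := forall w, size w != 1%N -> A w = 0.

Lemma letters_var i : letters (var R i).
Proof.
move=> w w1; rewrite /var; case: eqP => // we; by rewrite we in w1.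
Qed.

Lemma letters_nil A : letters A -> A [::] = 0.
Proof. exact. Qed.

Lemma lettersM_cons A h i w : letters A -> (A * h) (i :: w) = A [:: i] * h w.
Proof.
move=> lA; rewrite ncM /= big_nat_recl// take0 lA// mul0r add0r.
rewrite big_nat_recl//= take0 drop0 big1_seq ?addr0// => k.
rewrite mem_index_iota => /andP[_ /andP[_ kw]]; rewrite lA ?mul0r//=.
by case: w kw.
Qed.

Lemma lettersM_rcons A h i w : letters A -> (h * A) (rcons w i) = h w * A [:: i].
Proof.
move=> lA; rewrite ncM size_rcons big_nat_recr//= big_nat_recr//=.
rewrite [take (size w).+1 _]take_oversize ?size_rcons//.
rewrite [drop (size w).+1 _]drop_oversize ?size_rcons//.
rewrite [A [::]]lA// mulr0 addr0 -cats1 take_size_cat// drop_size_cat//.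
rewrite big1_seq ?add0r// => k; rewrite mem_index_iota => /andP[_ /andP[_ kw]].
by rewrite lA ?mulr0// size_drop size_cat/= addn1 subSn ?(ltnW kw)// eqSS subn_eq0 -ltnNge.
Qed.

Definition wder f : ncseries R := fun w => (weight w)%:R * f w.

Lemma wderE f w : wder f w = (weight w)%:R * f w. Proof. by []. Qed.

Lemma wderD f g : wder (f + g) = wder f + wder g.
Proof. by apply/funext => w; rewrite wderE !ncD mulrDr. Qed.

Lemma wderZ c f : wder (c *: f) = c *: wder f.
Proof. by apply/funext => w; rewrite wderE !ncZ mulrCA. Qed.

Lemma wderB f g : wder (f - g) = wder f - wder g.
Proof. by apply/funext => w; rewrite wderE !ncB mulrBr. Qed.

Lemma wderM f g : wder (f * g) = wder f * g + f * wder g.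
Proof.
apply/funext => w; rewrite wderE ncD !ncM mulr_sumr -big_split/=.
apply: eq_bigr => k _; rewrite !wderE -{1}(cat_take_drop k w) weight_cat.
by rewrite natrD mulrDl mulrA; congr (_ + _); rewrite mulrCA.
Qed.

Lemma wder1 : wder 1 = 0.
Proof.
apply/funext => w; rewrite wderE nc1; case: eqP => [->|_]; last by rewrite mulr0.
by rewrite weight_nil mul0r.
Qed.

Lemma vanish_wder k f : vanish k f -> vanish k (wder f).
Proof. by move=> fk w wk; rewrite wderE fk// mulr0. Qed.

Definition lder i f : ncseries R := fun w => f (i :: w).

(* The coefficient of v in the Dynkin operator applied to f: the word v occurs in
   [X_i, h] only by stripping i from its front or from its back. *)
Fixpoint dynkin_rec (n : nat) f v : R[i] :=
  match n, v with
  | n'.+1, [:: i] => (i : nat)%:R * f [:: i]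
  | n'.+1, i :: v' =>
      dynkin_rec n' (lder i f) v' - dynkin_rec n' (lder (last i v') f) (belast i v')
  | _, _ => 0
  end.

Definition dynkin_op f : ncseries R := fun v => dynkin_rec (size v) f v.

Lemma dynkin_nil f : dynkin_op f [::] = 0. Proof. by []. Qed.
Lemma dynkin1 f i : dynkin_op f [:: i] = (i : nat)%:R * f [:: i]. Proof. by []. Qed.
Lemma dynkin_cons f i v : v != [::] ->
  dynkin_op f (i :: v) = dynkin_op (lder i f) v - dynkin_op (lder (last i v) f) (belast i v).
Proof. by case: v => // j v _; rewrite /dynkin_op /= size_belast. Qed.

(** [dynkin_cons] calls the operator on the tail and on [belast i v]; the latter is no subterm, so
    the induction is on length. *)
Lemma word_ind_dynkin (P : word -> Prop) :
  P [::] -> (forall i, P [:: i]) ->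
  (forall i v, v != [::] -> P v -> P (belast i v) -> P (i :: v)) ->
  forall v, P v.
Proof.
move=> P0 P1 PS v; have [n] := ubnP (size v); elim: n v => // n IH [|i [|j v]] //=.
rewrite ltnS => vn; apply: PS => //; apply: IH => //.
by rewrite size_belast.
Qed.

Lemma dynkinD f g : dynkin_op (f + g) = dynkin_op f + dynkin_op g.
Proof.
apply/funext => v; rewrite ncD; elim/word_ind_dynkin: v f g => [|i|i v v0 IH1 IH2] f g.
- by rewrite !dynkin_nil addr0.
- by rewrite !dynkin1 ncD mulrDr.
- rewrite !dynkin_cons//; have E j : lder j (f + g) = lder j f + lder j g by [].
  by rewrite !E IH1 IH2 opprD addrACA.
Qed.

Lemma dynkinZ c f : dynkin_op (c *: f) = c *: dynkin_op f.
Proof.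
apply/funext => v; rewrite ncZ; elim/word_ind_dynkin: v f => [|i|i v v0 IH1 IH2] f.
- by rewrite !dynkin_nil mulr0.
- by rewrite !dynkin1 ncZ mulrCA.
- rewrite !dynkin_cons//; have E j : lder j (c *: f) = c *: lder j f by [].
  by rewrite !E IH1 IH2 mulrBr.
Qed.

Lemma dynkin0 : dynkin_op 0 = 0.
Proof. by rewrite -[0 in LHS](scale0r 0) dynkinZ scale0r. Qed.

Lemma dynkinB f g : dynkin_op (f - g) = dynkin_op f - dynkin_op g.
Proof. by rewrite dynkinD -scaleN1r dynkinZ scaleN1r. Qed.

Lemma dynkin_sum (I : Type) (r : seq I) (P : pred I) (F : I -> ncseries R) :
  dynkin_op (\sum_(i <- r | P i) F i) = \sum_(i <- r | P i) dynkin_op (F i).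
Proof. by elim/big_rec2: _ => [|i x y _ <-]; rewrite ?dynkin0// dynkinD. Qed.

(** The recursion only moves letters between the two ends of a word, so D is homogeneous and acts on
    each degree separately. *)
Lemma dynkin_local f g v :
  (forall u, weight u = weight v -> f u = g u) -> dynkin_op f v = dynkin_op g v.
Proof.
elim/word_ind_dynkin: v f g => [|i|i v v0 IH1 IH2] f g fg //.
- by rewrite !dynkin1 fg.
- rewrite !dynkin_cons//; congr (_ - _).
    by apply: IH1 => u uv; rewrite /lder fg// !weight_cons uv.
  apply: IH2 => u uv; rewrite /lder fg// [in RHS]lastI weight_rcons weight_cons uv.
  by rewrite addnC.
Qed.

Lemma vanish_dynkin k f : vanish k f -> vanish k (dynkin_op f).
Proof.
move=> fk w wk; rewrite (@dynkin_local _ 0) ?dynkin0// => u uw.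
by rewrite fk// uw.
Qed.

Lemma dynkin_1 : dynkin_op 1 = 0.
Proof.
apply/funext => v; have [->//|v0] := eqVneq v [::].
rewrite (@dynkin_local _ 0) ?dynkin0// => u uv; rewrite nc1.
by rewrite -weight_eq0 uv weight_eq0 (negbTE v0).
Qed.

(** The rule that characterises D: D(X_i w) = [X_i, D w] for a nonempty word w. The term in N A
    comes from the empty word of h, where X_i is itself the last letter. *)
Lemma dynkin_lettersM A h : letters A ->
  dynkin_op (A * h) = h [::] *: wder A + bracket A (dynkin_op h).
Proof.
move=> lA; apply/funext => v; rewrite ncD ncZ /bracket ncB wderE.
elim/word_ind_dynkin: v => [|i|i v v0 _ _].
- by rewrite dynkin_nil !ncM_nil lA// dynkin_nil !(mulr0,mul0r) subrr addr0.
- rewrite dynkin1 !(lettersM_cons _ _ _ lA) (lettersM_rcons _ i [::] lA).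
  rewrite dynkin_nil mulr0 mul0r subrr addr0 weight_cons weight_nil.
  by rewrite addn0 [LHS]mulrA [LHS]mulrC.
- rewrite dynkin_cons// lA; last by case: v v0.
  rewrite !mulr0 add0r (lettersM_cons _ _ _ lA) [in RHS](lastI i v) (lettersM_rcons _ _ _ lA).
  have E j : lder j (A * h) = A [:: j] *: h.
    by apply/funext => w; rewrite /lder lettersM_cons.
  by rewrite !E !dynkinZ !ncZ [dynkin_op h _ * _]mulrC.
Qed.

End Algebra.

(** * Lie elements *)

Lemma finite_posnat_le n : finite_set [set i : posnat | (i <= n)%N].
Proof.
have := @finite_preimage _ _ [set k | (k <= n)%N] (val : posnat -> nat).
apply; first by move=> i j _ _ /val_inj.
by apply: sub_finite_set (finite_II n.+1) => k /=; rewrite ltnS.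
Qed.

Lemma finite_words n : finite_set [set w : word | weight w = n].
Proof.
have [m] := ubnP n; elim: m n => // m IH n; rewrite ltnS => nm.
apply: (@sub_finite_set _ _ ([set [::]] `|`
  \bigcup_(i in [set i : posnat | (i <= n)%N])
    (cons i @` [set w : word | weight w = n - i]%N))).
  move=> [|i w] /= wn; first by left.
  right; exists i => /=; rewrite -wn weight_cons ?leq_addr//.
  by exists w => //=; rewrite addKn.
rewrite finite_setU; split; first exact: finite_set1.
apply: bigcup_finite; first exact: finite_posnat_le.
move=> i /= iN; apply/finite_image/IH.
by apply: leq_trans nm; rewrite ltn_subrL (posnat_gt0 i) (leq_trans (posnat_gt0 i) iN).
Qed.

Definition words n : seq word :=
  finmap.enum_fset (fset_set [set w : word | weight w = n]).

Lemma mem_words n w : (w \in words n) = (weight w == n).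
Proof.
rewrite /words in_fset_set; last exact: finite_words.
by apply/idP/eqP; rewrite inE.
Qed.

Lemma words_uniq n : uniq (words n).
Proof. exact: finmap.fset_uniq. Qed.

Lemma fsbig_words (V : nmodType) n (F : word -> V) :
  \sum_(w \in [set w | weight w = n]) F w = \sum_(w <- words n) F w.
Proof. by rewrite fsbig_finite//; exact: finite_words. Qed.

Section Lie.
Variable R : realType.
Implicit Types (f g h A : ncseries R) (u v w : word) (i j : posnat) (c : R[i]).

Definition monomial w : ncseries R := fun v => (v == w)%:R.

Lemma monomial_nil : monomial [::] = 1. Proof. by []. Qed.

Lemma monomial_cons i w : monomial (i :: w) = var R i * monomial w.
Proof.
apply/funext => -[|j v]; first by rewrite ncM_nil letters_var// mul0r.
rewrite (lettersM_cons _ _ _ (@letters_var _ i)) /monomial /var !eqseq_cons andbT.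
by rewrite -natrM mulnb.
Qed.

Lemma wder_var i : wder (var R i) = (i : nat)%:R *: var R i.
Proof.
apply/funext => w; rewrite wderE ncZ /var; case: eqP => [->|]; last by rewrite !mulr0.
by rewrite weight_cons weight_nil addn0.
Qed.

Lemma bracketZr c f g : bracket f (c *: g) = c *: bracket f g.
Proof. by rewrite /bracket -scalerAl -scalerAr scalerBr. Qed.

Lemma bracketZl c f g : bracket (c *: f) g = c *: bracket f g.
Proof. by rewrite /bracket -scalerAl -scalerAr scalerBr. Qed.

Lemma bracketDl f g h : bracket (f + g) h = bracket f h + bracket g h.
Proof. by rewrite /bracket mulrDl mulrDr opprD addrACA. Qed.

Lemma bracketBl f g h : bracket (f - g) h = bracket f h - bracket g h.
Proof. by rewrite bracketDl -scaleN1r bracketZl scaleN1r. Qed.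

Lemma bracket_nil f g : bracket f g [::] = 0.
Proof. by rewrite /bracket ncB !ncM_nil mulrC subrr. Qed.

Lemma vanish_bracketl k f g : vanish k f -> vanish k (bracket f g).
Proof. by move=> fk; apply: vanishB; [apply: vanishMl|apply: vanishMr]. Qed.

Definition last_weight w : nat := if w is i :: w' then last i w' else 0%N.

Lemma dynkin_monomial w :
  dynkin_op (monomial w) = (last_weight w)%:R *: nested_bracket R w.
Proof.
elim: w => [|i [|j w] IH].
- by rewrite monomial_nil dynkin_1 scaler0.
- rewrite monomial_cons monomial_nil dynkin_lettersM; last exact: letters_var.
  by rewrite dynkin_1 /bracket mulr0 mul0r subrr addr0 nc1 eqxx scale1r wder_var.
- rewrite monomial_cons dynkin_lettersM; last exact: letters_var.
  by rewrite IH scale0r add0r bracketZr.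
Qed.

Lemma sum_words_monomial n f v :
  \sum_(u <- words n) f u * monomial u v = if weight v == n then f v else 0.
Proof.
have [vn|vn] := eqVneq.
  rewrite (bigD1_seq v) ?words_uniq ?mem_words ?vn//= /monomial eqxx mulr1 big1 ?addr0//.
  by move=> u; rewrite eq_sym => /negbTE ->; rewrite mulr0.
rewrite big1_seq// => u /andP[_]; rewrite mem_words => /eqP un.
rewrite /monomial; case: eqP => [vu|_]; last by rewrite mulr0.
by rewrite vu un eqxx in vn.
Qed.

Lemma homogeneous_partE n f :
  homogeneous_part n f = \sum_(u <- words n) f u *: monomial u.
Proof. by apply/funext => v; rewrite nc_sum sum_words_monomial. Qed.

Lemma dynkin_words n f v : weight v = n ->
  dynkin_op f v = \sum_(u <- words n) f u * ((last_weight u)%:R * nested_bracket R u v).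
Proof.
move=> vn; rewrite (@dynkin_local _ _ (homogeneous_part n f)); last first.
  by move=> u uv; rewrite /homogeneous_part uv vn eqxx.
rewrite homogeneous_partE dynkin_sum nc_sum; apply: eq_bigr => u _.
by rewrite dynkinZ dynkin_monomial.
Qed.

Lemma nested_bracket_weight w v :
  weight v != weight w -> nested_bracket R w v = 0.
Proof.
elim: w v => [|i [|j w] IH] v //.
  by move=> H; rewrite /= /var; case: eqP => // E; rewrite E eqxx in H.
rewrite weight_cons => vw.
rewrite -[nested_bracket _ _]/(bracket (var R i) (nested_bracket R (j :: w))) /bracket ncB.
case: v vw => [|k v]; first by rewrite !ncM_nil letters_var// mulr0 mul0r subrr.
move=> H; rewrite (lettersM_cons _ _ _ (@letters_var _ i)).
rewrite (lastI k v) (lettersM_rcons _ _ _ (@letters_var _ i)) /var !eqseq_cons !andbT.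
have -> : (k == i)%:R * nested_bracket R (j :: w) v = 0.
  case: eqP => [ki|_]; last by rewrite mul0r.
  rewrite IH ?mulr0//; apply: contra H => /eqP H.
  by rewrite weight_cons H ki.
case: eqP => [ki|_]; last by rewrite mulr0 subr0.
rewrite IH ?mul0r ?subr0//; apply: contra H => /eqP H.
by rewrite lastI weight_rcons H ki addnC.
Qed.

Lemma lie_subalgebra_sum (L : set (ncseries R)) (I : eqType) (r : seq I)
    (F : I -> ncseries R) : lie_subalgebra L ->
  (forall x, x \in r -> L (F x)) -> L (\sum_(x <- r) F x).
Proof.
move=> [L0 LD _ _]; elim: r => [|x r IH] rL; first by rewrite big_nil.
rewrite big_cons; apply: LD; first by apply: rL; rewrite mem_head.
by apply: IH => y yr; apply: rL; rewrite in_cons yr orbT.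
Qed.

Lemma lie_subalgebra_free_lie n : lie_subalgebra (@free_lie R n).
Proof.
split.
- by move=> M [[M0 _ _ _] _].
- by move=> f g fL gL M MM; case: (MM) => -[_ MD _ _] _; apply: MD; [apply: fL|apply: gL].
- by move=> a f fL M MM; case: (MM) => -[_ _ MZ _] _; apply: MZ; apply: fL.
- by move=> f g fL gL M MM; case: (MM) => -[_ _ _ MB] _; apply: MB; [apply: fL|apply: gL].
Qed.

Lemma free_lie_var n i : (i <= n)%N -> free_lie n (var R i).
Proof. by move=> iN M [_]; apply; exists i. Qed.

Lemma free_lie_nested_bracket n w :
  (weight w <= n)%N -> free_lie n (nested_bracket R w).
Proof.
have [L0 _ _ LB] := lie_subalgebra_free_lie n.
elim: w => [|i [|j w] IH] // wn.
  by apply: free_lie_var; rewrite weight_cons weight_nil addn0 in wn.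
move: wn; rewrite weight_cons => wn; apply: LB.
  by apply: free_lie_var; apply: leq_trans wn; rewrite leq_addr.
by apply: IH; apply: leq_trans wn; rewrite leq_addl.
Qed.

(* The third condition makes the class closed under brackets; the second one is
   the Dynkin-Specht-Wever property of Lie elements. *)
Definition dynkin_primitive f :=
  [/\ f [::] = 0, wder f = dynkin_op f &
      forall h, h [::] = 0 -> dynkin_op (f * h) = bracket f (dynkin_op h)].

Lemma dynkin_primitive_var i : dynkin_primitive (var R i).
Proof.
split => //; last first.
  by move=> h h0; rewrite dynkin_lettersM ?h0 ?scale0r ?add0r//; exact: letters_var.
have := dynkin_monomial [:: i]; rewrite -[monomial _]/(var R i) => ->.
exact: wder_var.
Qed.

Lemma bracket_jacobi f g h :
  bracket f (bracket g h) - bracket g (bracket f h) = bracket (bracket f g) h.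
Proof.
apply/funext => w; rewrite /bracket !mulrBr !mulrBl !mulrA !ncB; ring.
Qed.

(** For brackets, D(f g) = [f, D g] = [f, N g], so D[f, g] = [f, N g] - [g, N f] = N[f, g]; the
    third condition is inherited by the Jacobi identity. *)
Lemma lie_subalgebra_dynkin_primitive : lie_subalgebra dynkin_primitive.
Proof.
split.
- split => //; first by rewrite dynkin0; apply/funext => w; rewrite wderE mulr0.
  by move=> h _; rewrite mul0r dynkin0 /bracket mul0r mulr0 subrr.
- move=> f g [f0 fN fD] [g0 gN gD]; split.
  + by rewrite ncD f0 g0 addr0.
  + by rewrite wderD fN gN dynkinD.
  + by move=> h h0; rewrite mulrDl dynkinD fD// gD// bracketDl.
- move=> a f [f0 fN fD]; split.
  + by rewrite ncZ f0 mulr0.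
  + by rewrite wderZ fN dynkinZ.
  + by move=> h h0; rewrite -scalerAl dynkinZ fD// bracketZl.
- move=> f g [f0 fN fD] [g0 gN gD]; split.
  + exact: bracket_nil.
  + rewrite /bracket wderB !wderM dynkinB fD// gD// fN gN /bracket.
    by apply/funext => w; rewrite !(ncB, ncD); ring.
  + move=> h h0.
    have -> : bracket f g * h = f * (g * h) - g * (f * h) by rewrite mulrBl !mulrA.
    by rewrite -bracket_jacobi dynkinB fD ?gD ?fD ?ncM_nil ?h0 ?mulr0.
Qed.

Lemma vanish_all f : (forall n, vanish n f) -> f = 0.
Proof. by move=> fn; apply/funext => w; exact: (fn (weight w).+1). Qed.

Definition trunc n f : ncseries R := fun w => if (weight w < n)%N then f w else 0.

Lemma vanish_sub_trunc n f : vanish n (f - trunc n f).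
Proof. by move=> w wn; rewrite ncB /trunc wn subrr. Qed.

Lemma truncE n f : trunc n f = \sum_(0 <= k < n) homogeneous_part k f.
Proof.
apply/funext => w; rewrite nc_sum /trunc /homogeneous_part.
have [wn|wn] := ltnP (weight w) n.
  rewrite (bigD1_seq (weight w)) ?mem_index_iota ?iota_uniq//= eqxx big1 ?addr0//.
  by move=> k; rewrite eq_sym => /negbTE->.
rewrite big1_seq// => k; rewrite mem_index_iota => /andP[_ /andP[_ kn]].
by rewrite gtn_eqF// (leq_trans kn).
Qed.

(** Each homogeneous part is a Lie polynomial, hence primitive. The third condition mixes degrees,
    so it is proved for truncations of f and transferred to f modulo t^n for all n. *)
Lemma lie_elementsP f : lie_elements f -> dynkin_primitive f.
Proof.
move=> [f0 fL]; have [G0 _ _ _] := lie_subalgebra_dynkin_primitive.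
have hP n : dynkin_primitive (homogeneous_part n f).
  have [->|n0] := posnP n.
    rewrite [homogeneous_part _ _](_ : _ = 0)//.
    apply/funext => w; rewrite /homogeneous_part; case: eqP => // /eqP.
    by rewrite weight_eq0 => /eqP->.
  apply: fL => //; split; first exact: lie_subalgebra_dynkin_primitive.
  by move=> _ [i _ ->]; exact: dynkin_primitive_var.
have tP n : dynkin_primitive (trunc n f).
  rewrite truncE; apply: lie_subalgebra_sum => //.
  exact: lie_subalgebra_dynkin_primitive.
split => //.
- apply/funext => w; have [_ E _] := hP (weight w).
  have := congr1 (fun F => F w) E; rewrite wderE /homogeneous_part eqxx -wderE => ->.
  by apply: dynkin_local => u ->; rewrite eqxx.
- move=> h h0; apply/eqP; rewrite -subr_eq0; apply/eqP/vanish_all => n.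
  have [_ _ E] := tP n; have V : vanish n (f - trunc n f) by exact: vanish_sub_trunc.
  rewrite -[f](subrK (trunc n f)) mulrDl dynkinD bracketDl E// opprD addrACA subrr addr0.
  by apply: vanishB; [apply/vanish_dynkin/vanishMl|apply: vanish_bracketl].
Qed.

(** Dynkin-Specht-Wever: in degree n the equation reads n f_n = D(f_n), and D always produces
    combinations of nested brackets. *)
Lemma dynkin_fixed_lie_elements f :
  f [::] = 0 -> wder f = dynkin_op f -> lie_elements f.
Proof.
move=> f0 fN; split => // n n0.
have -> : homogeneous_part n f = \sum_(u <- words n)
    (n%:R^-1 * (f u * (last_weight u)%:R)) *: nested_bracket R u.
  apply/funext => v; rewrite nc_sum /homogeneous_part; case: eqP => [vn|/eqP vn].
    have n0' : (n%:R : R[i]) != 0 by rewrite pnatr_eq0 -lt0n.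
    apply: (mulfI n0'); rewrite -{1}vn -wderE fN (dynkin_words _ vn) mulr_sumr.
    by apply: eq_bigr => u _; rewrite ncZ !mulrA mulfV// mul1r.
  rewrite big1_seq// => u /andP[_]; rewrite mem_words => /eqP un.
  by rewrite ncZ nested_bracket_weight ?mulr0// un.
apply: lie_subalgebra_sum; first exact: lie_subalgebra_free_lie.
move=> u; rewrite mem_words => /eqP un.
have [_ _ LZ _] := lie_subalgebra_free_lie n.
by apply: LZ; apply: free_lie_nested_bracket; rewrite un.
Qed.

Lemma lie_elementsE : @lie_elements R = dynkin_primitive.
Proof.
rewrite eqEsubset; split=> [f|f [f0 fN _]]; first exact: lie_elementsP.
exact: dynkin_fixed_lie_elements.
Qed.

Lemma lie_subalgebra_lie_elements : lie_subalgebra (@lie_elements R).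
Proof. by rewrite lie_elementsE; exact: lie_subalgebra_dynkin_primitive. Qed.

End Lie.

(** * Group-like series *)

Section GroupLike.
Variable R : realType.
Implicit Types (f g h : ncseries R) (u v w : word) (i j : posnat) (c : R[i]).

Lemma vanish_sum (I : eqType) (r : seq I) k (F : I -> ncseries R) :
  (forall x, x \in r -> vanish k (F x)) -> vanish k (\sum_(x <- r) F x).
Proof.
by move=> Fk w wk; rewrite nc_sum big1_seq// => x /andP[_ xr]; apply: Fk.
Qed.

(** The two double sums differ by products a_k b_l with k + l >= n, all of them O(t^n). *)
Lemma vanish_cauchy (a b : nat -> ncseries R) n :
  (forall k, vanish k (a k)) -> (forall k, vanish k (b k)) ->
  vanish n ((\sum_(0 <= k < n) a k) * (\sum_(0 <= k < n) b k) -
            \sum_(0 <= k < n) \sum_(0 <= l < k.+1) a l * b (k - l)%N).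
Proof.
move=> aV bV.
have -> : \sum_(0 <= k < n) \sum_(0 <= l < k.+1) a l * b (k - l)%N =
    \sum_(0 <= k < n) a k * \sum_(0 <= l < n - k) b l.
  elim: n => [|n IH]; first by rewrite !big_nil.
  rewrite big_nat_recr//= IH.
  have -> : \sum_(0 <= k < n.+1) a k * \sum_(0 <= l < n.+1 - k) b l =
     \sum_(0 <= k < n.+1) (a k * \sum_(0 <= l < n - k) b l + a k * b (n - k)%N).
    apply: eq_big_nat => k /andP[_]; rewrite ltnS => kn.
    by rewrite subSn// big_nat_recr//= mulrDr.
  rewrite big_split/= [in RHS]big_nat_recr//= subnn [X in _ * X]big_geq//.
  by rewrite mulr0 addr0.
rewrite mulr_suml -sumrB; apply: vanish_sum => k.
rewrite mem_index_iota => /andP[_ kn]; rewrite -mulrBr.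
rewrite (@big_cat_nat _ _ _ (n - k) 0 n) ?leq_subr//= [X in a k * X]addrC addKr.
rewrite -[n in vanish n](subnKC (ltnW kn)); apply: vanishM => //.
apply: vanish_sum => l; rewrite mem_index_iota => /andP[kl _].
exact: vanishW (bV l).
Qed.

Definition divided_power f n : ncseries R := (n`!%:R)^-1 *: f ^+ n.

Lemma vanish_divided_power f n : f [::] = 0 -> vanish n (divided_power f n).
Proof. by move=> f0; apply/vanishZ/vanishX. Qed.

Lemma divided_power0 f : divided_power f 0 = 1.
Proof. by rewrite /divided_power expr0 fact0 invr1 scale1r. Qed.

Lemma divided_power1 f : divided_power f 1 = f.
Proof. by rewrite /divided_power expr1 factS mul1n fact0 invr1 scale1r. Qed.

Lemma divided_powerS f n : n.+1%:R *: divided_power f n.+1 = f * divided_power f n.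
Proof.
rewrite /divided_power -scalerAr -exprS scalerA; congr (_ *: _).
by rewrite factS natrM invfM mulrA mulfV ?mul1r// pnatr_eq0.
Qed.

(** The exponential computed coefficientwise: when f has no constant term, f^k is O(t^k), so the sum
    may stop at the weight of w. *)
Definition expser f : ncseries R :=
  fun w => \sum_(0 <= k < (weight w).+1) divided_power f k w.

Lemma expserE f n w : f [::] = 0 -> (weight w < n)%N ->
  expser f w = \sum_(0 <= k < n) divided_power f k w.
Proof.
move=> f0 wn; rewrite (@big_cat_nat _ _ _ (weight w).+1 0 n)//= addrC big1_seq ?add0r//.
move=> k /andP[_]; rewrite mem_index_iota => /andP[wk _].
exact: vanish_divided_power.
Qed.

Lemma vanish_expser f n : f [::] = 0 ->
  vanish n (expser f - \sum_(0 <= k < n) divided_power f k).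
Proof. by move=> f0 w wn; rewrite ncB nc_sum (expserE f0 wn) subrr. Qed.

Lemma expser_nil f : expser f [::] = 1.
Proof. by rewrite /expser weight_nil big_nat1 divided_power0 nc1 eqxx. Qed.

(** The exponential is tangent to the identity: its terms of order at least 2 gain a degree on f -
    g. This drives the inductions on degree for injectivity, for the logarithm and for
    [lie_elements_of_grouplike]. *)
Lemma vanish_expserB f g k : f [::] = 0 -> g [::] = 0 -> vanish k (f - g) ->
  vanish k.+1 (expser f - expser g - (f - g)).
Proof.
move=> f0 g0 fg w; rewrite ltnS => wk; rewrite !ncB.
(* One term more than the weight demands, so that the constant and linear terms can be split off
   even for k = 0. *)
rewrite (@expserE f k.+2)// ?(@expserE g k.+2)// 1?ltnS 1?leqW//.
have E2 (F : nat -> R[i]) : \sum_(0 <= l < k.+2) F l =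
    F 0%N + (F 1%N + \sum_(0 <= l < k) F l.+2) by rewrite !big_nat_recl.
rewrite !E2 !divided_power0 !divided_power1 nc1.
set a := (\sum_(_ <= _ < _) _); set b := (\sum_(_ <= _ < _) _).
suff -> : a = b by ring.
apply/eqP; rewrite -subr_eq0 -sumrB big1_seq// => l _.
rewrite /divided_power !ncZ -mulrBr -ncB (@vanish_subX _ l.+2 k)//= ?mulr0//.
by rewrite addnS ltnS (leq_trans wk)// leq_addr.
Qed.

Definition grouplike g := g [::] = 1 /\ wder g = dynkin_op g * g.

Lemma wder_sum (I : Type) (r : seq I) (P : pred I) (F : I -> ncseries R) :
  wder (\sum_(x <- r | P x) F x) = \sum_(x <- r | P x) wder (F x).
Proof.
elim/big_rec2: _ => [|x y z _ <-]; last by rewrite wderD.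
by rewrite -[0 in LHS](scale0r 0) wderZ scale0r.
Qed.

(** This is N(exp f) = D(exp f) exp f sorted by powers of f. With e_n = f^n / n!, the induction
    applies N to f e_n = (n + 1) e_(n+1). *)
Lemma wder_divided_power f n : dynkin_primitive f ->
  wder (divided_power f n) =
  \sum_(0 <= k < n.+1) dynkin_op (divided_power f k) * divided_power f (n - k).
Proof.
move=> [f0 fN fD]; set e := divided_power f.
have eS k : f * e k = k.+1%:R *: e k.+1 by rewrite /e divided_powerS.
(* For k = 0 the constant term of e_0 = 1 rules out the third property of [dynkin_primitive]; there
   D(f) = N f supplies the extra term. *)
have De k : dynkin_op (f * e k) = (k == 0%N)%:R *: wder f + bracket f (dynkin_op (e k)).
  case: k => [|k].
    rewrite /e divided_power0 mulr1 dynkin_1 -fN scale1r.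
    by rewrite /bracket mulr0 mul0r subrr addr0.
  rewrite fD ?scale0r ?add0r//; apply: vanish_divided_power => //.
  by rewrite weight_nil.
have e0 : e 0%N = 1 by rewrite /e divided_power0.
clearbody e; elim: n => [|n IH]; first by rewrite big_nat1 e0 wder1 dynkin_1 mul0r.
have n0 : (n.+1%:R : R[i]) != 0 by rewrite pnatr_eq0.
apply: (scalerI n0); rewrite -wderZ -eS wderM IH scaler_sumr.
(* Splits n + 1 as k + (n + 1 - k): the first share turns k e_k into f e_(k-1) inside D, the second
   turns (n + 1 - k) e_(n+1-k) into f e_(n-k). *)
transitivity (\sum_(0 <= k < n.+2) ((k%:R *: dynkin_op (e k)) * e (n.+1 - k)%N) +
   \sum_(0 <= k < n.+2) (dynkin_op (e k) * ((n.+1 - k)%N%:R *: e (n.+1 - k)%N))); last first.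
  rewrite -big_split/=; apply: eq_big_nat => k /andP[_]; rewrite ltnS => kn.
  rewrite -scalerAl -scalerAr -scalerDl -natrD subnKC//.
rewrite [in X in _ = X + _]big_nat_recl//= mulr0n scale0r mul0r add0r [in X in _ = _ + X]big_nat_recr//= subnn.
rewrite mulr0n scale0r mulr0 addr0.
have -> : \sum_(0 <= k < n.+1) k.+1%:R *: dynkin_op (e k.+1) * e (n.+1 - k.+1)%N =
    wder f * e n + \sum_(0 <= k < n.+1) bracket f (dynkin_op (e k)) * e (n - k)%N.
  rewrite (eq_bigr (fun k => ((k == 0%N)%:R *: wder f) * e (n - k)%N +
                      bracket f (dynkin_op (e k)) * e (n - k)%N)); last first.
    by move=> k _; rewrite -dynkinZ -eS De mulrDl subSS.
  rewrite big_split/=; congr (_ + _).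
  rewrite big_nat_recl// subn0 scale1r big1 ?addr0// => k _.
  by rewrite scale0r mul0r.
rewrite -addrA -big_split/= mulr_sumr; congr (_ + _).
apply: eq_big_nat => k /andP[_]; rewrite ltnS => kn.
by rewrite subSn// -eS /bracket mulrBl !mulrA subrK.
Qed.

Lemma grouplike_expser f : lie_elements f -> grouplike (expser f).
Proof.
rewrite lie_elementsE => fP; split; first exact: expser_nil.
have f0 : f [::] = 0 by case: fP.
apply/eqP; rewrite -subr_eq0; apply/eqP/vanish_all => n.
set e := divided_power f; set E := expser f; set T := \sum_(0 <= k < n) e k.
have ET : vanish n (E - T) by exact: vanish_expser.
have TT : vanish n (dynkin_op T * T - wder T).
  rewrite /T wder_sum dynkin_sum.
  rewrite [X in _ - X](eq_bigr _ (fun k _ => wder_divided_power k fP)).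
  apply: vanish_cauchy => k; last exact: vanish_divided_power.
  exact/vanish_dynkin/vanish_divided_power.
have -> : wder E - dynkin_op E * E = wder (E - T) - dynkin_op (E - T) * E -
    dynkin_op T * (E - T) - (dynkin_op T * T - wder T).
  rewrite wderB dynkinB mulrBl mulrBr.
  by apply/funext => w; rewrite !(ncB, ncD); ring.
apply: vanishB => //; apply: vanishB; last exact: vanishMr.
by apply: vanishB; [exact: vanish_wder|exact/vanishMl/vanish_dynkin].
Qed.

(* The quadratic equation wder g = dynkin_op g * g linearises to the
   Dynkin-Specht-Wever equation on the lowest-degree part of a difference. *)
Lemma grouplike_sub_lowest g h n : grouplike g -> grouplike h ->
  vanish n (g - h) -> (0 < n)%N ->
  vanish n.+1 (wder (g - h) - dynkin_op (g - h)).
Proof.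
move=> [g1 gE] [h1 hE] gh n0.
have -> : wder (g - h) - dynkin_op (g - h) =
    dynkin_op (g - h) * (g - 1) + dynkin_op h * (g - h).
  rewrite wderB gE hE dynkinB !mulrBr !mulrBl !mulr1.
  by apply/funext => w; rewrite !(ncB, ncD); ring.
apply: vanishD.
  rewrite -addn1; apply: vanishM; first exact: vanish_dynkin.
  by apply: vanish_nil; rewrite ncB g1 nc1 subrr.
rewrite -add1n; apply: vanishM => //; apply: vanish_nil; exact: dynkin_nil.
Qed.

(** By induction the truncation of f below degree n is Lie, so its exponential is group-like. In
    degree n the two exponentials differ exactly as f and its truncation do, and
    [grouplike_sub_lowest] applies to that difference. *)
Lemma lie_elements_of_grouplike f :
  f [::] = 0 -> grouplike (expser f) -> lie_elements f.
Proof.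
move=> f0 fG; apply: dynkin_fixed_lie_elements => //.
apply/eqP; rewrite -subr_eq0; apply/eqP/vanish_all => n.
elim: n => // n IH.
have [->|n0] := posnP n.
  by apply: vanish_nil; rewrite ncB wderE f0 mulr0 dynkin_nil subrr.
have t0 : trunc n f [::] = 0 by rewrite /trunc; case: ifP.
have tL : lie_elements (trunc n f).
  apply: dynkin_fixed_lie_elements => //; apply/funext => w.
  have [wn|wn] := ltnP (weight w) n.
    rewrite wderE /trunc wn -wderE (@dynkin_local _ _ f).
      by apply/eqP; rewrite -subr_eq0 -ncB IH.
    by move=> u ->; rewrite wn.
  rewrite wderE /trunc ltnNge wn mulr0 (@dynkin_local _ _ 0) ?dynkin0//.
  by move=> u ->; rewrite ltnNge wn.
have ft : vanish n (f - trunc n f) by exact: vanish_sub_trunc.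
have EV := vanish_expserB f0 t0 ft.
set d := expser f - expser (trunc n f) in EV.
have dV : vanish n d.
  rewrite -[d](subrK (f - trunc n f)); apply: vanishD => //.
  exact: vanishW EV.
have dN := grouplike_sub_lowest fG (grouplike_expser tL) dV n0.
have -> : wder f - dynkin_op f = (wder d - dynkin_op d) - (wder (d - (f - trunc n f)) -
     dynkin_op (d - (f - trunc n f))) + (wder (trunc n f) - dynkin_op (trunc n f)).
  rewrite !wderB !dynkinB.
  by apply/funext => w; rewrite !(ncB, ncD); ring.
move: tL; rewrite lie_elementsE => -[_ -> _]; rewrite subrr addr0.
apply: vanishB => //; apply: vanishB; [exact: vanish_wder|exact: vanish_dynkin].
Qed.

(* exp is inverted by the fixed-point iteration f |-> f + g - exp f. *)
Fixpoint log_iter g n : ncseries R :=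
  if n is n'.+1 then log_iter g n' + (g - expser (log_iter g n')) else 0.

Lemma log_iter_nil g n : g [::] = 1 -> log_iter g n [::] = 0.
Proof.
by move=> g1; elim: n => //= n IH; rewrite ncD ncB IH g1 expser_nil subrr addr0.
Qed.

(** Since exp is tangent to the identity, each correction by the current error gains one degree. *)
Lemma vanish_log_iter g n : g [::] = 1 -> vanish n.+1 (g - expser (log_iter g n)).
Proof.
move=> g1; elim: n => [|n IH].
  by apply: vanish_nil; rewrite ncB g1 expser_nil subrr.
have L0 := log_iter_nil _ g1.
have := @vanish_expserB (log_iter g n.+1) (log_iter g n) n.+1 (L0 _) (L0 _).
rewrite /= [_ + _ - log_iter g n]addrAC subrr add0r => /(_ IH) /vanishN.
by congr vanish; apply/funext => w; rewrite !(ncB, ncD, ncN); ring.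
Qed.

(** Diagonal of the iteration: from the n-th iterate on, coefficients up to degree n no longer
    change. *)
Definition logser g : ncseries R := fun w => log_iter g (weight w) w.

Lemma log_iter_stable g n k : g [::] = 1 ->
  vanish n.+1 (log_iter g (n + k) - log_iter g n).
Proof.
move=> g1; elim: k => [|k IH]; first by rewrite addn0 subrr.
rewrite addnS /= [_ + (g - _)]addrC -addrA; apply: vanishD => //.
by apply: (vanishW _ (@vanish_log_iter g (n + k) g1)); rewrite ltnS leq_addr.
Qed.

Lemma vanish_logser g n : g [::] = 1 -> vanish n.+1 (logser g - log_iter g n).
Proof.
move=> g1 w; rewrite ltnS => wn; rewrite ncB /logser.
have := @log_iter_stable g (weight w) (n - weight w)%N g1 w (ltnSn _).
by rewrite subnKC// => /(congr1 -%R); rewrite ncB opprB oppr0.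
Qed.

Lemma logser_nil g : g [::] = 1 -> logser g [::] = 0.
Proof. exact: log_iter_nil. Qed.

Lemma logserK g : g [::] = 1 -> expser (logser g) = g.
Proof.
move=> g1; apply/eqP; rewrite -subr_eq0; apply/eqP/vanish_all => -[//|n].
have := vanish_expserB (logser_nil g1) (log_iter_nil n g1) (@vanish_logser g n g1).
have V1 := @vanish_logser g n g1; have V2 := @vanish_log_iter g n g1.
set a := expser _; set b := expser _; set x := logser _; set y := log_iter _ _.
move=> V3; have -> : a - g = (a - b - (x - y)) + (x - y) - (g - b).
  by apply/funext => w; rewrite !(ncB, ncD, ncN); ring.
apply: vanishB => //; apply: vanishD => //; exact: vanishW V3.
Qed.

Lemma expser_inj f g : f [::] = 0 -> g [::] = 0 -> expser f = expser g -> f = g.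
Proof.
move=> f0 g0 fg; apply/eqP; rewrite -subr_eq0; apply/eqP/vanish_all.
elim=> // n IH; have := vanish_expserB f0 g0 IH.
by rewrite fg subrr sub0r => /vanishN; rewrite opprK.
Qed.

End GroupLike.

(** * Generation by exponentials of letters *)

Section Generation.
Variable R : realType.
Implicit Types (f g h : ncseries R) (u v w : word) (i j : posnat) (c : R[i]).

(* exp(y X_i) *)
Definition letter_exp (y : R[i]) i : ncseries R :=
  fun w => if all (pred1 i) w then (size w)`!%:R^-1 * y ^+ size w else 0.

Lemma letter_exp_nil y i : letter_exp y i [::] = 1.
Proof. by rewrite /letter_exp/= fact0 expr0 invr1 mulr1. Qed.

Lemma letter_exp0 i : letter_exp 0 i = 1.
Proof.
apply/funext => -[|j w]; first by rewrite letter_exp_nil nc1.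
by rewrite /letter_exp nc1/= exprS mul0r mulr0 if_same.
Qed.

Lemma letter_expM y z i : letter_exp y i * letter_exp z i = letter_exp (y + z) i.
Proof.
apply/funext => w; rewrite ncM /letter_exp.
have [wi|/negP wi] := boolP (all (pred1 i) w); last first.
  rewrite big1_seq// => k _.
  case: ifP => [t|_]; last by rewrite mul0r.
  case: ifP => [d|_]; last by rewrite mulr0.
  by case: wi; rewrite -(cat_take_drop k w) all_cat t d.
rewrite addrC exprDn mulr_sumr big_mkord; apply: eq_bigr => k _.
have kw : (k <= size w)%N by rewrite -ltnS.
move: wi; rewrite -{1}(cat_take_drop k w) all_cat => /andP[-> ->].
rewrite size_takel// size_drop -mulr_natr -(bin_fact kw) !natrM.
have F m : (m`!%:R : R[i]) != 0 by rewrite pnatr_eq0 -lt0n fact_gt0.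
have B : ('C(size w, k)%:R : R[i]) != 0 by rewrite pnatr_eq0 -lt0n bin_gt0.
have H := F k; have H2 := F (size w - k)%N.
set a : R[i] := _%:R in B *; set b : R[i] := _%:R in H *; set d : R[i] := _%:R in H2 *.
by field; rewrite B H H2.
Qed.

(** The quadratic term has degree 2 i >= i + 1. *)
Lemma vanish_letter_exp y i :
  vanish i.+1 (letter_exp y i - 1 - y *: var R i).
Proof.
move=> w; rewrite ltnS => wi; rewrite !ncB ncZ nc1 /letter_exp /var.
case: w wi => [|j [|k w]] wi.
- by rewrite /= fact0 expr0 invr1; ring.
- rewrite /= andbT eqseq_cons eqxx andbT (factS 0) fact0 muln1 invr1 expr1.
  by case: eqP => _; rewrite ?mul1r ?mulr1 ?mulr0 !subr0 ?subrr.
- rewrite ifF/= ?eqseq_cons ?andbF ?mulr0 ?subr0//.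
  apply/negbTE/negP => /and3P[/eqP ji /eqP ki _]; move: wi.
  rewrite !weight_cons ji ki leqNgt -{1}(addn0 i) ltn_add2l.
  by rewrite addn_gt0 (posnat_gt0 i).
Qed.

Lemma vanish_bracket m k f g :
  vanish m f -> vanish k g -> vanish (m + k)%N (bracket f g).
Proof.
move=> fm gk; apply: vanishB; first exact: vanishM.
by rewrite addnC; apply: vanishM.
Qed.

Lemma vanish_nested_bracket w : vanish (weight w) (nested_bracket R w).
Proof. by move=> v vw; rewrite nested_bracket_weight// ltn_eqF. Qed.

(** An abstract group of group-like series containing the exponentials of letters; it will be the
    set of finite products of such exponentials. *)
Variable S : set (ncseries R).
Hypothesis S_1 : S 1.
Hypothesis S_mul : forall g h, S g -> S h -> S (g * h).
Hypothesis S_inv : forall g, S g -> exists2 h, S h & g * h = 1 /\ h * g = 1.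
Hypothesis S_grouplike : S `<=` @grouplike R.
Hypothesis S_letter_exp : forall y i, S (letter_exp y i).

(* The commutator of exp(c X_i) and 1 + p + ... is 1 + c [X_i, p] + ... *)
Lemma approx_nested_bracket c w : w != [::] ->
  exists2 h, S h & vanish (weight w).+1 (h - 1 - c *: nested_bracket R w).
Proof.
elim: w c => [|i [|j w] IH] c // _.
  exists (letter_exp c i) => //; rewrite weight_cons weight_nil addn0.
  exact: vanish_letter_exp.
(* The scalar c is carried by the exponential of the outer letter, so the inner bracket is taken
   with coefficient 1. *)
have [h Sh hP] := IH 1 isT; set p := nested_bracket R (j :: w) in hP.
have [h' Sh' [hh' h'h]] := S_inv Sh.
set e := letter_exp c i; have Se : S e by exact: S_letter_exp.
have [e' Se' [ee' e'e]] := S_inv Se.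
have eP : vanish i.+1 (e - 1 - c *: var R i) by exact: vanish_letter_exp.
exists (e * h * (e' * h')); first by do !apply: S_mul.
rewrite weight_cons -[nested_bracket R _]/(bracket (var R i) p); set m := weight _ in hP *.
have pm : vanish m p by exact: vanish_nested_bracket.
have vi : vanish i (c *: var R i).
  by apply: vanishZ => v vi; rewrite /var; case: eqP vi => // ->;
    rewrite weight_cons weight_nil addn0 ltnn.
set q := bracket (e - 1) (h - 1).
have qP : vanish (i + m).+1 (q - c *: bracket (var R i) p).
  rewrite -bracketZl.
  have -> : q - bracket (c *: var R i) p = bracket (e - 1 - c *: var R i) (h - 1) +
      bracket (c *: var R i) (h - 1 - 1 *: p).
    rewrite scale1r bracketBl; set x := e - 1; set y := h - 1.
    rewrite -/x -/y /q /bracket !mulrBr !mulrBl.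
    by apply/funext => v; rewrite !(ncB, ncD, ncN); ring.
  apply: vanishD; last by rewrite -addnS; apply: vanish_bracket.
  rewrite -addSn; apply: vanish_bracket => //.
  rewrite -[h - 1](subrK (1 *: p)); apply: vanishD; last exact: vanishZ.
  exact: vanishW hP.
have qV : vanish (i + m) q.
  rewrite -[q](subrK (c *: bracket (var R i) p)); apply: vanishD; first exact: vanishW qP.
  by rewrite -bracketZl; exact: vanish_bracket.
have qE : q = e * h - h * e.
  rewrite /q /bracket !mulrBr !mulrBl !mulr1 !mul1r.
  by apply/funext => v; rewrite !(ncB, ncD, ncN); ring.
(* Since h e e' h' = 1, the commutator minus 1 equals (e h - h e) e' h' = q e' h', and e' h' is 1 up
   to positive degree. *)
have -> : e * h * (e' * h') - 1 - c *: bracket (var R i) p =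
    q * (e' * h' - 1) + (q - c *: bracket (var R i) p).
  rewrite addrA; congr (_ - _); rewrite mulrBr mulr1 subrK qE mulrBl.
  by rewrite -[h * e * _]mulrA [e * (e' * _)]mulrA ee' mul1r hh'.
apply: vanishD => //; rewrite -addn1; apply: vanishM => //.
by apply: vanish_nil; rewrite ncB ncM_nil nc1 (S_grouplike Sh').1 (S_grouplike Se').1 mulr1 subrr.
Qed.

(** Products add lowest-order terms: (1 + p)(1 + q) is 1 + p + q up to p q, which has higher
    degree. *)
Lemma approx_lie_poly n (a : word -> R[i]) (r : seq word) : (0 < n)%N ->
  (forall u, u \in r -> weight u = n) ->
  exists2 h, S h & vanish n.+1 (h - 1 - \sum_(u <- r) a u *: nested_bracket R u).
Proof.
move=> n0; elim: r => [|u r IH] rn; first by exists 1 => //; rewrite big_nil !subrr.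
have un : weight u = n by apply: rn; rewrite mem_head.
have [|h Sh hP] := IH; first by move=> v vr; apply: rn; rewrite in_cons vr orbT.
have u0 : u != [::] by rewrite -weight_eq0 un -lt0n.
have [h' Sh' h'P] := approx_nested_bracket (a u) u0.
exists (h' * h); first exact: S_mul.
rewrite big_cons; set q := \sum_(_ <- _) _ in hP *; set p := _ *: _ in h'P *.
rewrite un in h'P.
have -> : h' * h - 1 - (p + q) = (h' - 1 - p) + (h - 1 - q) + (h' - 1) * (h - 1).
  rewrite !mulrBr !mulrBl !mulr1 !mul1r.
  by apply/funext => v; rewrite !(ncB, ncD, ncN); ring.
apply: vanishD; first exact: vanishD.
rewrite -addn1; apply: vanishM.
  rewrite -[h' - 1](subrK p); apply: vanishD; first exact: vanishW h'P.
  by apply: vanishZ; rewrite -un; exact: vanish_nested_bracket.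
by apply: vanish_nil; rewrite ncB nc1 (S_grouplike Sh).1 subrr.
Qed.

(** Successive correction: the degree-n part of g - h is a Lie polynomial q, so multiplying h by an
    element 1 + q + ... of S removes it. *)
Lemma approx_grouplike g n : grouplike g -> exists2 h, S h & vanish n (g - h).
Proof.
move=> gG; elim: n => [|n [h Sh hP]]; first by exists 1.
have [->|n0] := posnP n.
  by exists 1 => //; apply: vanish_nil; rewrite ncB nc1 gG.1 subrr.
set d := g - h in hP; have hG := S_grouplike Sh.
have dV := grouplike_sub_lowest gG hG hP n0; rewrite -/d in dV.
(* Coefficients of q in nested brackets, read off from n d = D(d) in degree n. *)
set a := fun u => n%:R^-1 * (d u * (last_weight u)%:R).
have [|h' Sh' h'P] := @approx_lie_poly n a (words n) n0.
  by move=> u; rewrite mem_words => /eqP.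
set q := \sum_(_ <- _) _ in h'P.
have qV : vanish n q.
  apply: vanish_sum => u; rewrite mem_words => /eqP <-.
  by apply: vanishZ; exact: vanish_nested_bracket.
have dq : vanish n.+1 (d - q).
  move=> w; rewrite ltnS leq_eqVlt => /orP[/eqP wn|wn]; last first.
    by rewrite ncB hP// qV// subrr.
  have := dV w; rewrite wn ltnSn => /(_ isT); rewrite ncB wderE wn (dynkin_words _ wn).
  move=> /eqP; rewrite subr_eq0 => /eqP E.
  have n0' : (n%:R : R[i]) != 0 by rewrite pnatr_eq0 -lt0n.
  rewrite ncB; apply/eqP; rewrite subr_eq0; apply/eqP/(mulfI n0').
  rewrite E /q nc_sum mulr_sumr; apply: eq_bigr => u _.
  by rewrite ncZ /a !mulrA mulfV// mul1r.
exists (h * h'); first exact: S_mul.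
have -> : g - h * h' = (d - q) - h * (h' - 1 - q) - (h - 1) * q.
  rewrite /d !mulrBr !mulrBl !mulr1 !mul1r.
  by apply/funext => v; rewrite !(ncB, ncD, ncN); ring.
apply: vanishB; first by apply: vanishB => //; exact: vanishMr.
rewrite -add1n; apply: vanishM => //.
by apply: vanish_nil; rewrite ncB nc1 hG.1 subrr.
Qed.

End Generation.

(** * Action on formal power series *)

Section Center.
Variable R : realType.
Implicit Types (f g h : ncseries R) (u v w : word) (i j : posnat) (c : word -> R[i]).

(* Reading w from left to right, apply the operators r^(i+1) d/dr to r^(a+1):
   the result is center_coef a w times a power of r. *)
Fixpoint center_coef (a : nat) w : R[i] :=
  if w is i :: w' then a.+1%:R * center_coef (a + i) w' else 1.

Lemma center_coef_cat a u v :
  center_coef a (u ++ v) = center_coef a u * center_coef (a + weight u) v.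
Proof.
elim: u a => [|i u IH] a /=; first by rewrite weight_nil addn0 mul1r.
by rewrite IH weight_cons mulrA addnA.
Qed.

Lemma center_coefE a w :
  center_coef a w = \prod_(0 <= j < size w) (a + weight (take j w)).+1%:R.
Proof.
elim: w a => [|i w IH] a; first by rewrite big_nil.
rewrite /= big_nat_recl//= weight_nil addn0 IH; congr (_ * _).
by apply: eq_bigr => k _; rewrite weight_cons addnA.
Qed.

(** At n the total weight, the factor n - (i_1 + ... + i_j) + 1 is the weight of the letters still
    to come plus 1. After reversal these letters form a prefix, and the factors become the exponents
    produced by successive differentiations. *)
Lemma center_poly_rev w :
  (center_poly R (rev w)).[(weight w)%:R] = center_coef 0 w.
Proof.
rewrite /center_poly horner_prod center_coefE size_rev big_nat_rev big_add1 /=.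
rewrite big_nat_cond [RHS]big_nat_cond; apply: eq_bigr => j /andP[/andP[_ jw] _].
rewrite hornerD hornerXsubC hornerC add0n take_rev weight_rev.
rewrite subSS subKn 1?ltnW// -{1}(cat_take_drop j w) weight_cat natrD addrK.
by rewrite -natr1.
Qed.

(** The coefficient of r^(a+n+1) in the image of r^(a+1) under f. *)
Definition center_action (a : nat) f (n : nat) : R[i] :=
  \sum_(u <- words n) f u * center_coef a u.

Lemma center_action_local a f g n :
  (forall u, weight u = n -> f u = g u) -> center_action a f n = center_action a g n.
Proof.
move=> fg; rewrite /center_action big_seq [RHS]big_seq.
by apply: eq_bigr => u; rewrite mem_words => /eqP /fg ->.
Qed.

Lemma center_action_vanish a f g m n : (n < m)%N -> vanish m (f - g) ->
  center_action a f n = center_action a g n.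
Proof.
move=> nm fg; apply: center_action_local => u un; apply/eqP.
by rewrite -subr_eq0 -ncB fg ?un.
Qed.

Lemma center_actionD a f g n :
  center_action a (f + g) n = center_action a f n + center_action a g n.
Proof. by rewrite -big_split/=; apply: eq_bigr => u _; rewrite ncD mulrDl. Qed.

Lemma center_actionZ a (x : R[i]) f n :
  center_action a (x *: f) n = x * center_action a f n.
Proof. by rewrite mulr_sumr; apply: eq_bigr => u _; rewrite ncZ mulrA. Qed.

Lemma center_action0 a n : center_action a 0 n = 0.
Proof. by rewrite -(scale0r 0) center_actionZ mul0r. Qed.

Lemma center_actionB a f g n :
  center_action a (f - g) n = center_action a f n - center_action a g n.
Proof. by rewrite center_actionD -scaleN1r center_actionZ mulN1r. Qed.

Lemma center_action_sum (I : Type) (r : seq I) (P : pred I) (F : I -> ncseries R) a n :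
  center_action a (\sum_(x <- r | P x) F x) n =
  \sum_(x <- r | P x) center_action a (F x) n.
Proof.
by elim/big_rec2: _ => [|x y z _ <-]; rewrite ?center_action0// center_actionD.
Qed.

Lemma center_action_monomial a w n :
  center_action a (monomial R w) n = if weight w == n then center_coef a w else 0.
Proof.
rewrite /center_action; case: eqP => [wn|wn].
  rewrite (bigD1_seq w) ?words_uniq ?mem_words ?wn//= /monomial eqxx mul1r.
  by rewrite big1 ?addr0// => u /negbTE ->; rewrite mul0r.
rewrite big1_seq// => u /andP[_]; rewrite mem_words => /eqP un.
by rewrite /monomial; case: eqP => [E|]; [rewrite -E in wn|rewrite mul0r].
Qed.

Lemma monomial_cat u v : monomial R (u ++ v) = monomial R u * monomial R v.
Proof.
elim: u => [|i u IH] /=; first by rewrite monomial_nil mul1r.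
by rewrite !monomial_cons IH mulrA.
Qed.

Lemma center_action_homogeneousM a f g m l n :
  center_action a (homogeneous_part m f * homogeneous_part l g) n =
  if (m + l == n)%N then center_action a f m * center_action (a + m) g l else 0.
Proof.
rewrite !homogeneous_partE mulr_suml center_action_sum.
transitivity (\sum_(u <- words m) \sum_(v <- words l)
    f u * g v * center_action a (monomial R (u ++ v)) n).
  apply: eq_bigr => u _; rewrite mulr_sumr center_action_sum; apply: eq_bigr => v _.
  by rewrite -scalerAl -scalerAr scalerA center_actionZ monomial_cat.
case: eqP => mln; last first.
  rewrite big1_seq// => u /andP[_]; rewrite mem_words => /eqP um.
  rewrite big1_seq// => v /andP[_]; rewrite mem_words => /eqP vl.
  by rewrite center_action_monomial weight_cat um vl; case: eqP => // _; rewrite mulr0.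
rewrite mulr_suml big_seq [RHS]big_seq; apply: eq_bigr => u; rewrite mem_words => /eqP um.
rewrite mulr_sumr big_seq [RHS]big_seq; apply: eq_bigr => v; rewrite mem_words => /eqP vl.
rewrite center_action_monomial weight_cat um vl mln eqxx center_coef_cat um.
by rewrite mulrACA.
Qed.

(** The left factor acts first and sends r^(a+1) to multiples of r^(a+m+1), on which the right
    factor then acts. Truncation reduces the product to finitely many homogeneous parts. *)
Lemma center_actionM a f g n : center_action a (f * g) n =
  \sum_(0 <= m < n.+1) center_action a f m * center_action (a + m) g (n - m).
Proof.
have V h : vanish n.+1 (h - trunc n.+1 h) by exact: vanish_sub_trunc.
rewrite (@center_action_vanish a _ (trunc n.+1 f * trunc n.+1 g) n.+1)//; last first.
  have -> : f * g - trunc n.+1 f * trunc n.+1 g =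
      (f - trunc n.+1 f) * g + trunc n.+1 f * (g - trunc n.+1 g).
    by rewrite mulrBl mulrBr; apply/funext => v; rewrite !(ncB, ncD, ncN); ring.
  by apply: vanishD; [exact: vanishMl|exact: vanishMr].
rewrite !truncE mulr_suml center_action_sum.
rewrite big_nat_cond [RHS]big_nat_cond; apply: eq_bigr => m /andP[/andP[_ mn] _].
rewrite mulr_sumr center_action_sum (bigD1_seq (n - m)%N) ?iota_uniq//=; last first.
  by rewrite mem_index_iota/= ltnS leq_subr.
rewrite center_action_homogeneousM subnKC// eqxx big1 ?addr0// => l lnm.
rewrite center_action_homogeneousM; case: eqP => // E.
by rewrite -E addKn eqxx in lnm.
Qed.

Lemma center_action_at0 a f : center_action a f 0 = f [::].
Proof.
rewrite /center_action (bigD1_seq [::]) ?words_uniq ?mem_words ?weight_nil//=.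
rewrite mulr1 big1_seq ?addr0// => u /andP[u0]; rewrite mem_words weight_eq0.
by rewrite (negbTE u0).
Qed.

Lemma center_action_nested_bracket_neq a w n : weight w != n ->
  center_action a (nested_bracket R w) n = 0.
Proof.
move=> wn; rewrite -(center_action0 a n); apply: center_action_local => u un.
by rewrite nested_bracket_weight// un eq_sym.
Qed.

(* [r^(i+1) d/dr, r^(j+1) d/dr] = (j - i) r^(i+j+1) d/dr, and the action of words
   reverses products. *)
Lemma center_action_nested_bracket a w : w != [::] ->
  center_action a (nested_bracket R w) (weight w) = a.+1%:R * (gamma w)%:~R.
Proof.
elim: w a => [|i [|j w] IH] a // _.
  rewrite -[nested_bracket _ _]/(monomial R [:: i]) center_action_monomial eqxx /=.
  by rewrite !mulr1.
rewrite -[nested_bracket _ _]/(bracket (monomial R [:: i]) (nested_bracket R (j :: w))).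
set v := j :: w in IH *; have {}IH b := IH b isT.
have -> : gamma (i :: v) = ((i : nat)%:Z - (weight v)%:Z) * gamma v by [].
clearbody v; rewrite weight_cons /bracket center_actionB !center_actionM.
rewrite (bigD1_seq (i : nat)) ?iota_uniq//=; last first.
  by rewrite mem_index_iota/= ltnS leq_addr.
rewrite big1 ?addr0 => [|m mi]; last first.
  rewrite center_action_monomial weight_cons weight_nil addn0 eq_sym (negbTE mi).
  by rewrite mul0r.
rewrite (bigD1_seq (weight v)) ?iota_uniq//=; last first.
  by rewrite mem_index_iota/= ltnS leq_addl.
rewrite big1 ?addr0 => [|m mi]; last first.
  by rewrite center_action_nested_bracket_neq ?mul0r// eq_sym.
rewrite addKn addnK !IH !center_action_monomial weight_cons weight_nil addn0 eqxx.
(* With |v| the weight of v, what remains is (a+1)(a+i+1) - (a+1)(a+|v|+1) = (a+1)(i - |v|), times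
   the value of [gamma] at v. *)
rewrite /= !mulr1 intrM rmorphB/= -!pmulrn -!natr1 !natrD.
by ring.
Qed.

(** exp f - 1 = f q with q the sum of the f^k / (k+1)!, and f acts first: if f kills r, so does f q.
    Conversely, by induction on n only the term m = n of the product rule survives, and q has
    constant term 1. *)
Lemma center_action_expser f :
  f [::] = 0 ->
  (forall n, (0 < n)%N -> center_action 0 (expser f) n = 0) <->
  (forall n, (0 < n)%N -> center_action 0 f n = 0).
Proof.
move=> f0.
pose q n := \sum_(0 <= k < n) (k.+1`!%:R : R[i])^-1 *: f ^+ k.
have E n : (0 < n)%N -> center_action 0 (expser f) n =
    \sum_(0 <= m < n.+1) center_action 0 f m * center_action m (q n) (n - m).
  move=> n0; rewrite (center_action_vanish _ (ltnSn n) (vanish_expser f0)).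
  rewrite big_nat_recl//= divided_power0.
  rewrite [X in 1 + X](_ : _ = f * q n).
    rewrite center_actionD center_actionM -monomial_nil center_action_monomial.
    by rewrite weight_nil eq_sym eqn0Ngt n0 add0r.
  by rewrite mulr_sumr; apply: eq_bigr => k _; rewrite /divided_power exprS scalerAr.
split=> H n n0; last first.
  rewrite E// big1// => m _; have [->|m0] := posnP m; last by rewrite H// mul0r.
  by rewrite center_action_at0 f0 mul0r.
elim/ltn_ind: n n0 => n IH n0; have := H n n0.
rewrite E// big_nat_recr//= subnn center_action_at0 big1_seq ?add0r.
  case: n {IH} n0 => // n _.
  rewrite /q big_nat_recl// ncD nc_sum big1 ?addr0 => [|k _].
    by rewrite expr0 (factS 0) fact0 muln1 invr1 scale1r nc1 mulr1.
  by rewrite ncZ ncX_nil f0 expr0n mulr0.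
move=> m; rewrite mem_index_iota => /andP[_ /andP[_ mn]].
have [->|m0] := posnP m; last by rewrite IH// mul0r.
by rewrite center_action_at0 f0 mul0r.
Qed.

Lemma sum_words_rev n (F : word -> R[i]) :
  \sum_(w <- words n) F (rev w) = \sum_(w <- words n) F w.
Proof.
rewrite -(big_map rev xpredT F); apply: perm_big; apply: uniq_perm.
- by rewrite map_inj_uniq ?words_uniq//; exact: (can_inj revK).
- exact: words_uniq.
move=> w; rewrite mem_words; apply/mapP/eqP => [[u]|wn].
  by rewrite mem_words => /eqP <- ->; rewrite weight_rev.
by exists (rev w); rewrite ?revK// mem_words weight_rev wn.
Qed.

Lemma center_actionE f n : center_action 0 f n =
  \sum_(w <- words n) (center_poly R w).[n%:R] * f (rev w).
Proof.
rewrite -sum_words_rev /center_action big_seq [RHS]big_seq.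
apply: eq_bigr => w; rewrite mem_words => /eqP <-.
by rewrite revK mulrC -center_poly_rev.
Qed.

End Center.

(** * Topology *)

Section Topology.
Variable R : realType.
Implicit Types (f g h : ncseries R) (u v w : word) (i j : posnat) (c : word -> R[i]).
Local Notation C := ((R[i])^o).

Lemma cvg_ncseriesP (F : set_system (ncseries R)) (FF : Filter F) g :
  F --> g <-> forall w, (fun h : ncseries R => h w : C) @ F --> (g w : C).
Proof.
split=> [Fg w|Fg].
  exact: (cvg_comp _ _ Fg (@proj_continuous word (fun=> C) w g)).
apply/cvg_sup => w U [V] [[W oW <-] Wg WU].
apply: (filterS WU); apply: (Fg w W).
by apply: open_nbhs_nbhs; split.
Qed.

Lemma ncseries_hausdorff : hausdorff_space (ncseries R).
Proof.
apply: (@hausdorff_product word (fun=> C)) => _; exact: norm_hausdorff.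
Qed.

Definition cvg_coef (T : Type) (F : set_system T) (f : T -> ncseries R) g :=
  forall w, (fun x => f x w : C) @ F --> (g w : C).

Section CvgCoef.
Variables (T : Type) (F : set_system T).
Context {FF : Filter F}.
Implicit Types (p q : T -> ncseries R).

Lemma cvg_coefP p g : p @ F --> g <-> cvg_coef F p g.
Proof. exact: cvg_ncseriesP. Qed.

Lemma cvg_coef_cst g : cvg_coef F (fun=> g) g.
Proof. by move=> w; exact: cvg_cst. Qed.

Lemma cvg_coefZ (a : R[i]) p f : cvg_coef F p f ->
  cvg_coef F (fun x => a *: p x) (a *: f).
Proof. by move=> pf w; apply: (@cvgMl_tmp _ _ F); exact: pf. Qed.

Lemma cvg_coefB p q f g : cvg_coef F p f -> cvg_coef F q g ->
  cvg_coef F (fun x => p x - q x) (f - g).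
Proof. by move=> pf qg w; apply: (@cvgB _ C); [exact: pf|exact: qg]. Qed.

Lemma cvg_scalar_sum (I : Type) (r : seq I) (P : pred I) (a : I -> T -> C) (b : I -> C) :
  (forall k, P k -> a k x @[x --> F] --> b k) ->
  \sum_(k <- r | P k) a k x @[x --> F] --> \sum_(k <- r | P k) b k.
Proof. by move=> ab; apply: cvg_big => //; exact: add_continuous. Qed.

Lemma cvg_coefM p q f g : cvg_coef F p f -> cvg_coef F q g ->
  cvg_coef F (fun x => p x * q x) (f * g).
Proof.
move=> pf qg w; apply: cvg_scalar_sum => k _.
by apply: (@cvgM _ _ F); [exact: pf|exact: qg].
Qed.

Lemma cvg_coefX n p f : cvg_coef F p f -> cvg_coef F (fun x => p x ^+ n) (f ^+ n).
Proof.
move=> pf; elim: n => [|n IH]; first exact: cvg_coef_cst.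
have := cvg_coefM pf IH; rewrite -exprS; congr (cvg_coef F _ _).
by apply/funext => x; rewrite exprS.
Qed.

Lemma cvg_coef_expser p f : cvg_coef F p f ->
  cvg_coef F (fun x => expser (p x)) (expser f).
Proof.
by move=> pf w; apply: cvg_scalar_sum => k _;
  have := @cvg_coefZ (k`!%:R)^-1 _ _ (@cvg_coefX k _ _ pf) w; exact.
Qed.

(** Gives continuity of the logarithm by induction on weight: the coefficient of g at w is that of
    exp g - exp(trunc g), and the truncation only involves coefficients of smaller weight. *)
Lemma cvg_coef_expser_inv p f : (forall x, p x [::] = 0) -> f [::] = 0 ->
  cvg_coef F (fun x => expser (p x)) (expser f) -> cvg_coef F p f.
Proof.
move=> p0 f0 pf w; have [n] := ubnP (weight w); elim: n w => // n IH w.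
rewrite ltnS => wn.
have E g : g [::] = 0 -> g w = (expser g - expser (trunc (weight w) g)) w.
  move=> g0; have t0 : trunc (weight w) g [::] = 0 by rewrite /trunc; case: ifP.
  have V : vanish (weight w) (g - trunc (weight w) g) by exact: vanish_sub_trunc.
  have := vanish_expserB g0 t0 V (ltnSn (weight w)); rewrite !ncB.
  have -> : trunc (weight w) g w = 0 by rewrite /trunc ltnn.
  by rewrite subr0 => /eqP; rewrite subr_eq0 => /eqP.
rewrite E// (_ : (fun x => _) =
  fun x => (expser (p x) - expser (trunc (weight w) (p x))) w); last first.
  by apply/funext => x; rewrite E.
suff : cvg_coef F (fun x => expser (p x) - expser (trunc (weight w) (p x)))
  (expser f - expser (trunc (weight w) f)) by exact.
apply: cvg_coefB; first exact: pf.
apply: cvg_coef_expser => u; rewrite /trunc.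
case: ltnP => uw; last exact: cvg_cst.
by apply: IH; exact: (leq_trans uw wn).
Qed.

Lemma cvg_coef_wder p f : cvg_coef F p f ->
  cvg_coef F (fun x => wder (p x)) (wder f).
Proof. by move=> pf w; apply: (@cvgMl_tmp _ _ F); exact: pf. Qed.

Lemma cvg_coef_dynkin_op p f : cvg_coef F p f ->
  cvg_coef F (fun x => dynkin_op (p x)) (dynkin_op f).
Proof.
move=> pf w; elim/word_ind_dynkin: w p f pf => [|i|i v v0 IH1 IH2] p f pf.
- exact: cvg_cst.
- by apply: (@cvgMl_tmp _ _ F); exact: pf.
- rewrite dynkin_cons// (_ : (fun x => _) = fun x => dynkin_op (lder i (p x)) v -
    dynkin_op (lder (last i v) (p x)) (belast i v)); last first.
    by apply/funext => x; rewrite dynkin_cons.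
  by apply: (@cvgB _ C); [apply: IH1|apply: IH2] => w; exact: pf.
Qed.

End CvgCoef.

Lemma nc_limE (s : nat -> ncseries R) g : cvg_coef \oo s g -> lim (s @ \oo) = g.
Proof. by move=> /cvg_coefP; apply: cvg_lim; exact: ncseries_hausdorff. Qed.

Lemma nc_expE f : f [::] = 0 -> nc_exp f = expser f.
Proof.
move=> f0; apply: nc_limE => w; apply: cvg_near_cst; exists (weight w).+1 => //= n /= wn.
by rewrite nc_sum (expserE f0 wn).
Qed.

Lemma lie_seriesE c v :
  lie_series c v = \sum_(u <- words (weight v)) c u * nested_bracket R u v.
Proof.
rewrite /lie_series; move: v; apply/funeqP; apply: nc_limE => v.
apply: cvg_near_cst; exists (weight v).+1 => //= n /= vn.
rewrite nc_sum (eq_bigr (fun k => \sum_(u <- words k) c u * nested_bracket R u v)); last first.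
  by move=> k _; rewrite fsbig_words nc_sum.
(* The series starts in degree 1 while the right-hand side at the empty word is a sum over degree 0;
   there the nested bracket is 0. *)
have [v0|v0] := eqVneq v [::].
  rewrite v0 weight_nil big1_seq => [|k /andP[_]]; last first.
    rewrite mem_index_iota => /andP[k0 _]; rewrite big1_seq// => u.
    rewrite mem_words => /andP[_ /eqP uk].
    by rewrite nested_bracket_weight ?mulr0// weight_nil uk eq_sym -lt0n.
  rewrite big1_seq// => u /andP[_]; rewrite mem_words weight_eq0 => /eqP ->.
  by rewrite mulr0.
rewrite (bigD1_seq (weight v)) ?iota_uniq//=; last first.
  by rewrite mem_index_iota vn lt0n weight_eq0 v0.
rewrite [X in _ + X]big1 ?addr0// => k kv; rewrite big1_seq// => u /andP[_].
rewrite mem_words => /eqP uk.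
by rewrite nested_bracket_weight ?mulr0// uk eq_sym.
Qed.

Lemma lie_elements_lie_series c : lie_elements (lie_series c).
Proof.
split=> [|n n0]; first by rewrite /lie_G/= lie_seriesE weight_nil big1_seq// => u;
  rewrite mem_words weight_eq0 => /andP[_ /eqP ->]; rewrite mulr0.
have -> : homogeneous_part n (lie_series c) = \sum_(u <- words n) c u *: nested_bracket R u.
  apply/funext => v; rewrite nc_sum /homogeneous_part; case: eqP => [<-|/eqP vn].
    by rewrite lie_seriesE.
  rewrite big1_seq// => u /andP[_]; rewrite mem_words => /eqP un.
  by rewrite ncZ nested_bracket_weight ?mulr0// un.
apply: lie_subalgebra_sum; first exact: lie_subalgebra_free_lie.
move=> u; rewrite mem_words => /eqP un; have [_ _ LZ _] := lie_subalgebra_free_lie R n.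
by apply: LZ; apply: free_lie_nested_bracket; rewrite un.
Qed.

Lemma lie_element_lie_series f : lie_elements f -> exists c, f = lie_series c.
Proof.
rewrite lie_elementsE => -[f0 fN _].
(* Division of n f_n = D(f_n) by n gives these coefficients; at the empty word the inverse of 0 is
   harmless because the nested bracket is 0. *)
exists (fun u => (weight u)%:R^-1 * (f u * (last_weight u)%:R)).
apply/funext => v; rewrite lie_seriesE; have [->|v0] := eqVneq v [::].
  by rewrite f0 big1_seq// => u; rewrite mem_words weight_nil weight_eq0 => /andP[_ /eqP ->]; rewrite mulr0.
have n0 : ((weight v)%:R : R[i]) != 0 by rewrite pnatr_eq0 weight_eq0.
apply: (mulfI n0); rewrite -wderE fN (dynkin_words _ erefl) mulr_sumr.
rewrite big_seq [RHS]big_seq; apply: eq_bigr => u; rewrite mem_words => /eqP ->.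
by rewrite !mulrA mulfV// mul1r.
Qed.

Lemma center_action_lie_series c n : (0 < n)%N ->
  center_action 0 (lie_series c) n = \sum_(u <- words n) c u * (gamma u)%:~R.
Proof.
move=> n0.
rewrite (@center_action_local _ _ _ (\sum_(u <- words n) c u *: nested_bracket R u)).
  rewrite center_action_sum big_seq [RHS]big_seq; apply: eq_bigr => u.
  rewrite mem_words center_actionZ => /eqP un; rewrite -un center_action_nested_bracket.
    by rewrite mul1r.
  by rewrite -weight_eq0 un -lt0n.
by move=> u un; rewrite lie_seriesE nc_sum un.
Qed.

(** At each word the group-like equation involves finitely many coefficients, so its defect depends
    continuously on the series; it is 0 on E, hence at every limit point. *)
Lemma grouplike_closure (E : set (ncseries R)) :
  E `<=` @grouplike R -> closure E `&` @group_G R `<=` @grouplike R.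
Proof.
move=> EG g [Eg g1]; split => //; apply/funext => w.
pose F := within E (nbhs g); have FF : ProperFilter F by exact: within_nbhs_proper.
have idF : cvg_coef F id g by apply/cvg_ncseriesP; exact: cvg_within.
have D := cvg_coefB (cvg_coef_wder idF) (cvg_coefM (cvg_coef_dynkin_op idF) idF) (w := w).
have D0 : (fun x => (wder (id x) - dynkin_op (id x) * id x) w : C) @ F --> (0 : C).
  apply: cvg_near_cst; apply: (@filterS _ _ _ E); last exact: withinT.
  by move=> h /EG [_ ->]; rewrite subrr.
have /eqP : (wder g - dynkin_op g * g) w = 0.
  exact: (cvg_unique (@norm_hausdorff _ C) (D _ _ _ _) D0).
by rewrite ncB subr_eq0 => /eqP.
Qed.

(** Agreement modulo t^n makes each coefficient of the approximating sequence eventually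
    constant. *)
Lemma closure_approx (E : set (ncseries R)) g :
  (forall n, exists2 h, E h & vanish n (g - h)) -> closure E g.
Proof.
move=> gE; have gE' n : exists h, E h /\ vanish n (g - h).
  by have [h] := gE n; exists h.
have [h hE] := boolp.choice gE'.
have : h @ \oo --> g.
  apply/cvg_coefP => w; apply: cvg_near_cst; exists (weight w).+1 => //= n /= wn.
  by apply/eqP; rewrite eq_sym -subr_eq0; apply/eqP; exact: (hE n).2.
move=> hg B /hg [n _ nB]; exists (h n); split; first exact: (hE n).1.
by apply: nB => /=.
Qed.

Lemma within_continuous_unique (E S : set (ncseries R)) (J K : ncseries R -> C) :
  E `<=` S -> S `<=` closure E -> {within S, continuous J} ->
  {within S, continuous K} -> (forall g, E g -> J g = K g) ->
  forall g, S g -> J g = K g.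
Proof.
move=> ES SE /subspace_continuousP cJ /subspace_continuousP cK JK g Sg.
pose F := within E (nbhs g).
have Eg : closure E g by exact: SE.
have FF : ProperFilter F := @within_nbhs_proper _ E g Eg.
have FS : F --> within S (nbhs g).
  move=> A H; change (nbhs g [set x | E x -> A x]).
  by apply: (@filterS _ (nbhs g) _ _ _ _ H) => x HA /ES; exact: HA.
apply: (@cvg_unique C (@norm_hausdorff _ C) (J @ F)).
  exact: cvg_trans (cvg_app J FS) (cJ g Sg).
have KF : K @ F --> K g by exact: cvg_trans (cvg_app K FS) (cK g Sg).
apply: cvg_trans KF; apply: near_eq_cvg.
by apply: (@filterS _ _ _ E); [move=> h /JK|exact: withinT].
Qed.

Lemma nc_exp_bij : set_bij (@lie_G R) (@group_G R) (@nc_exp R).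
Proof.
split.
- by move=> f f0; rewrite /group_G/= nc_expE// expser_nil.
- by move=> f g; rewrite !inE => f0 g0; rewrite !nc_expE//; exact: expser_inj.
- move=> g g1; exists (logser g); first exact: logser_nil.
  by rewrite nc_expE ?logserK//; exact: logser_nil.
Qed.

Lemma nc_logE g : g [::] = 1 -> nc_log g = logser g.
Proof.
move=> g1; rewrite -{1}(logserK g1) -nc_expE; last exact: logser_nil.
have [_ inj _] := nc_exp_bij; rewrite /nc_log pinvKV// inE; exact: logser_nil.
Qed.

Lemma nc_exp_homeomorphism (A B : set (ncseries R)) :
  A `<=` @lie_G R -> B = @nc_exp R @` A -> homeomorphism_between A B (@nc_exp R).
Proof.
move=> A0 ->; split.
- split; [by move=> f Af; exists f| |by move=> g].
  have [_ inj _] := nc_exp_bij; move=> f g; rewrite !inE => /A0 f0 /A0 g0.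
  by apply: inj; rewrite inE.
- apply/subspace_continuousP => f Af.
  change (@nc_exp R @ within A (nbhs f) --> nc_exp f); rewrite (nc_expE (A0 _ Af)).
  have idF : cvg_coef (within A (nbhs f)) id f by apply/cvg_ncseriesP; exact: cvg_within.
  have /cvg_coefP EF : cvg_coef (within A (nbhs f)) (@expser R) (expser f).
    exact: cvg_coef_expser.
  apply: cvg_trans EF; apply: near_eq_cvg.
  by apply: (@filterS _ _ _ A); [move=> h /A0 /nc_expE|exact: withinT].
- exists (@logser R); split.
    move=> f; rewrite inE => /A0 f0; rewrite nc_expE// -nc_logE ?expser_nil//.
    have [_ inj _] := nc_exp_bij.
    by rewrite -(nc_expE f0) /nc_log pinvKV// inE.
  apply/subspace_continuousP => _ [f Af <-]; have f0 := A0 _ Af.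
  change (@logser R @ within (nc_exp (R:=R) @` A) (nbhs (nc_exp f)) --> logser (nc_exp f)).
  set D := nc_exp (R:=R) @` A; set g := nc_exp f.
  have D1 h : D h -> h [::] = 1.
    by move=> [k /A0 k0 <-]; rewrite nc_expE// expser_nil.
  have Dg : D g by exists f.
  apply/cvg_coefP; apply: cvg_coef_expser_inv => [x||].
  + by rewrite /logser weight_nil.
  + by rewrite /logser weight_nil.
  rewrite logserK ?D1//.
  have idF : cvg_coef (within D (nbhs g)) id g by apply/cvg_ncseriesP; exact: cvg_within.
  apply/cvg_coefP; move/cvg_coefP : idF => idF; apply: cvg_trans idF.
  apply: near_eq_cvg; apply: (@filterS _ _ _ D); last exact: withinT.
  by move=> h /D1 /logserK.
Qed.

End Topology.

(** * Lipschitz functions and indefinite integrals *)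

Section RealAnalysis.
Variable R : realType.
Local Notation mu := (@lebesgue_measure R).
Implicit Types (f g : R -> R) (a b x y : R).

(** Let s be the supremum of the points up to which P holds. The third hypothesis gives P at s, and
    the second would push the supremum further unless s = b. *)
Lemma real_induction (P : R -> Prop) a b : P a ->
  (forall s, a <= s < b -> P s ->
    exists2 d, 0 < d & forall y, s < y < s + d -> y <= b -> P y) ->
  (forall s, a < s <= b -> (forall y, a <= y < s -> P y) -> P s) ->
  forall x, a <= x <= b -> P x.
Proof.
move=> Pa Pr Pl x /andP[ax xb].
pose S := [set s | a <= s <= b /\ forall y, a <= y <= s -> P y].
have ab : a <= b by exact: le_trans xb.
have Sa : S a.
  by split=> [|y /le_anti <-//]; rewrite lexx ab.
have Sub : has_ubound S by exists b => s [/andP[]].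
have Ssup : has_sup S by split => //; exists a.
set s := sup S.
have as_ : a <= s by exact: ub_le_sup.
have sb : s <= b by apply: ge_sup; [exists a|move=> y [/andP[]]].
have Slt y : a <= y < s -> P y.
  move=> /andP[ay ys]; have e0 : 0 < s - y by rewrite subr_gt0.
  have [z [_ zP]] := sup_adherent e0 Ssup.
  rewrite opprB addrC subrK => yz; apply: zP; rewrite ay/=; exact: ltW.
have Ps : P s.
  have [<-//|sa] := eqVneq a s; apply: Pl => //.
  by rewrite lt_neqAle sa as_.
have Ss : S s.
  split=> [|y /andP[ay]]; first by rewrite as_.
  by rewrite le_eqVlt => /predU1P[->//|ys]; apply: Slt; rewrite ay.
have [sltb|bs] := ltP s b; last first.
  by case: Ss => _; apply; rewrite ax (le_trans xb).
have [|d d0 dP] := Pr s _ Ps; first by rewrite as_.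
pose e := Num.min (d / 2) (b - s).
have e0 : 0 < e by rewrite lt_min divr_gt0//= subr_gt0.
have ebs : e <= b - s by rewrite ge_min lexx orbT.
have ed : e <= d / 2 by rewrite ge_min lexx.
have : s + e <= s.
  apply: ub_le_sup => //; split=> [|y /andP[ay ye]]; first by apply/andP; split; lra.
  have [ys|sy] := leP y s; first by case: Ss => _; apply; rewrite ay.
  by apply: dP; [rewrite sy/=|]; lra.
by rewrite gerDl leNgt e0.
Qed.

Definition lip a b f := exists K : R,
  forall x y, x \in `[a, b] -> y \in `[a, b] -> `|f x - f y| <= K * `|x - y|.

Lemma lip_ge0 a b f : lip a b f -> exists2 K : R, 0 <= K &
  forall x y, x \in `[a, b] -> y \in `[a, b] -> `|f x - f y| <= K * `|x - y|.
Proof.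
move=> [K Kf]; exists `|K| => // x y xI yI; apply: (le_trans (Kf x y xI yI)).
by rewrite ler_wpM2r// ler_norm.
Qed.

(* Off an open set U of small measure containing the bad points, f moves at rate
   at most e; inside U it moves at rate at most K. *)
Lemma lip_derive0_bound a b f (K e : R) : a <= b -> 0 <= K -> 0 < e ->
  (forall x y, x \in `[a, b] -> y \in `[a, b] -> `|f x - f y| <= K * `|x - y|) ->
  {ae mu, forall x, x \in `]a, b[ -> is_derive x 1 f 0} ->
  `|f b - f a| <= e * (b - a) + K * e.
Proof.
move=> ab K0 e0 Kf [A [mA A0 AP]].
(* The endpoints join the null set because the derivative is only known on the open interval. *)
pose D := A `|` ([set a] `|` [set b]).
have mD : measurable D by apply: measurableU => //; exact: measurableU.
have D0 : mu D = 0%E.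
  apply/negligibleP => //; apply: negligibleU; first exact/negligibleP.
  by apply: negligibleU; apply/negligibleP => //; exact: lebesgue_measure_set1.
have muDoo : (mu D < +oo)%E by rewrite D0 ltry.
have [U [oU DU muU]] := lebesgue_regularity_outer mD muDoo e0.
have mU : measurable U by exact: open_measurable.
have {}muU : (mu U < e%:E)%E.
  rewrite -(setDUK DU); apply: le_lt_trans muU.
  apply: (le_trans (measureU2 _ _ _)) => //; first exact: measurableD.
  by rewrite [X in (X + _ <= _)%E](D0 : _ = 0%E) add0e.
pose m x := fine (mu (U `&` `[a, x])).
have mI x : measurable (U `&` `[a, x]) by exact: measurableI.
have mmono (A1 A2 : set R) : measurable A1 -> measurable A2 -> A1 `<=` A2 -> (mu A1 <= mu A2)%E.
  by move=> m1 m2 m12; apply: le_measure => //; exact: mem_set.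
have mfin x : (mu (U `&` `[a, x]) \is a fin_num).
  rewrite ge0_fin_numE ?measure_ge0//.
  apply: (@le_lt_trans _ _ (mu U)); last exact: (lt_trans muU (ltry _)).
  by apply: mmono => // ? [].
have mle x y : x <= y -> m x <= m y.
  move=> xy; apply: fine_le => //; apply: mmono => //.
  apply: setIS => z /=; rewrite !in_itv/= => /andP[-> zx]; exact: (le_trans zx).
have me x : m x <= e.
  rewrite -lee_fin /m fineK//; apply/ltW; apply: le_lt_trans muU.
  by apply: mmono => // ? [].
have mU_step s y : a <= s -> s <= y -> `]s, y] `<=` U -> m s + (y - s) <= m y.
  move=> as_ sy syU; rewrite -lee_fin EFinD /m !fineK//.
  have -> : ((y - s)%:E = mu `]s, y])%E.
    rewrite lebesgue_measure_itv/= lte_fin.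
    by case: ltP => // ys; rewrite (@le_anti _ _ s y) ?subrr// sy.
  have UE : (mu (U `&` `[a, s] `|` `]s, y]) = mu (U `&` `[a, s]) + mu `]s, y])%E.
    apply: measureU => //; first exact: mI.
    rewrite -subset0 => z [[_]]/=; rewrite !in_itv/= => /andP[_ zs] /andP[sz _].
    by move: sz; rewrite ltNge zs.
  rewrite -UE; apply: mmono => //; first exact: measurableU.
  move=> z [[Uz] /= zas|/= zsy]; split => //=.
  - by move: zas; rewrite !in_itv/= => /andP[-> zs]; exact: (le_trans zs).
  - exact: syU.
  - move: zsy; rewrite !in_itv/= => /andP[sz ->].
    by rewrite andbT (le_trans as_)// ltW.
(* The inequality propagated from a to b; the bound m b <= e turns it into the claim. *)
pose P x := `|f x - f a| <= e * (x - a) + K * m x.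
suff : P b.
  by move=> H; apply: (le_trans H); rewrite lerD2l ler_wpM2l.
have inI x : a <= x -> x <= b -> x \in `[a, b] by rewrite in_itv/= => -> ->.
apply: (@real_induction P a b) => //; last by rewrite ab lexx.
- rewrite /P !subrr normr0 mulr0 add0r mulr_ge0// /m fine_ge0//.
- move=> s /andP[as_ sb] Ps.
  have [sU|sU] := pselect (U s).
    have /nbhs_ballP[d /= d0 dU] := open_nbhs_nbhs (conj oU sU).
    exists d => // y /andP[sy yd] yb; rewrite /P.
    have -> : f y - f a = (f y - f s) + (f s - f a) by rewrite addrA subrK.
    apply: (le_trans (ler_normD _ _)).
    have H1 : `|f y - f s| <= K * (y - s).
      have := Kf y s; rewrite (@gtr0_norm _ (y - s)) ?subr_gt0//; apply.
        by apply: inI => //; rewrite (le_trans as_)// ltW.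
      by apply: inI => //; exact: ltW.
    have H2 : m s + (y - s) <= m y.
      apply: mU_step => //; first exact: ltW.
      move=> z /=; rewrite in_itv/= => /andP[sz zy]; apply: dU => /=.
      rewrite /ball/= ltr0_norm ?subr_lt0// opprB ltrBlDl.
      exact: le_lt_trans yd.
    have H3 : K * m s + K * (y - s) <= K * m y by rewrite -mulrDr ler_wpM2l.
    have H4 : e * (s - a) <= e * (y - a) by rewrite ler_wpM2l ?ltW// ltrD2r.
    by move: Ps H1 H3 H4; rewrite /P => *; lra.
  have nA : ~ A s by move=> As; apply: sU; apply: DU; left.
  have sa : s \in `]a, b[.
    rewrite in_itv/= sb andbT lt_neqAle as_ andbT; apply/eqP => sa.
    by apply: sU; apply: DU; right; left => /=.
  have fs : is_derive s 1 f 0.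
    by apply: contrapT => nd; apply: nA; apply: AP => /= H; exact/nd/H.
  have fs0 : h^-1 *: ((f \o shift s) (h *: (1 : R)) - f s) @[h --> 0^'] --> 'D_1 f s.
    exact: (@ex_derive _ _ _ _ _ _ _ fs).
  rewrite (@derive_val _ _ _ _ _ _ _ fs) in fs0.
  have := @cvgr0_norm_le _ _ _ _ _ _ fs0 e e0.
  move=> H; have H0 : nbhs (0 : R) (fun h : R => h != 0 ->
    `|h^-1 *: ((f \o shift s) (h *: (1 : R)) - f s)| <= e) by exact: H.
  have [d /= d0 dP] := (nbhs_ballP _ _).1 H0.
  exists d => // y /andP[sy yd] yb; rewrite /P.
  have h0 : 0 < y - s by rewrite subr_gt0.
  have := dP (y - s); rewrite /ball/= sub0r normrN gtr0_norm// ltrBlDl => /(_ yd).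
  rewrite gt_eqF// => /(_ isT); rewrite /= [_ *: (1 : R)]mulr1 subrK normrZ normfV.
  rewrite gtr0_norm// mulrC ler_pdivrMr// => H1.
  have -> : f y - f a = (f y - f s) + (f s - f a) by rewrite addrA subrK.
  apply: (le_trans (ler_normD _ _)).
  have H2 : K * m s <= K * m y by rewrite ler_wpM2l// mle// ltW.
  move: Ps H1 H2; rewrite /P; set u := `|_|; set v := `|_|.
  set p := K * m s; set r := K * m y => *.
  have -> : e * (y - a) = e * (y - s) + e * (s - a) by ring.
  by lra.
- move=> s /andP[as_ sb] Plt; rewrite /P leNgt; apply/negP => H.
  set gap := `|f s - f a| - (e * (s - a) + K * m s).
  have gap0 : 0 < gap by rewrite subr_gt0.
  (* A violation by [gap] at s would persist at s - d, since moving back by d changes f by at most K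
     d <= gap / 2. *)
  pose d := Num.min (s - a) (gap / (2 * (K + 1))).
  have K1 : 0 < K + 1 by lra.
  have d0 : 0 < d by rewrite lt_min subr_gt0 as_/= divr_gt0// mulr_gt0.
  have dsa : d <= s - a by rewrite ge_min lexx.
  have dgap : d <= gap / (2 * (K + 1)) by rewrite ge_min lexx orbT.
  have ya : a <= s - d by lra.
  have := Plt (s - d); rewrite ya /= ltrBlDr ltrDl => /(_ d0); rewrite /P => H1.
  have H2 : `|f s - f (s - d)| <= K * d.
    have := Kf s (s - d); rewrite opprB [s + (d - s)]addrC subrK (gtr0_norm d0).
    by apply; apply: inI; lra.
  have H3 : K * m (s - d) <= K * m s by rewrite ler_wpM2l// mle//; lra.
  have H4 : `|f s - f a| <= `|f s - f (s - d)| + `|f (s - d) - f a|.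
    by apply: (le_trans _ (ler_normD _ _)); rewrite addrA subrK.
  have H5 : e * (s - d - a) <= e * (s - a) by rewrite ler_wpM2l ?ltW//; lra.
  have H6 : K * d <= gap / 2.
    have : (K + 1) * d <= gap / 2.
      rewrite -ler_pdivlMl//; apply: (le_trans dgap); rewrite invfM [X in _ <= X]mulrC.
      by rewrite mulrA.
    by rewrite mulrDl mul1r => H6; lra.
  by move: H1 H2 H3 H4 H5 H6 gap0; rewrite /gap; lra.
Qed.

Lemma ae_subset_itv a b x (P : R -> Prop) : x \in `[a, b] ->
  {ae mu, forall z, z \in `]a, b[ -> P z} -> {ae mu, forall z, z \in `]a, x[ -> P z}.
Proof.
rewrite in_itv/= => /andP[_ xb]; apply: filterS; first exact: (ae_filter_ringOfSetsType mu).
move=> z Pz; rewrite in_itv/= => /andP[az zx].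
by apply: Pz; rewrite in_itv/= az (lt_le_trans zx).
Qed.

Lemma lip_derive0_cst a b f : lip a b f ->
  {ae mu, forall x, x \in `]a, b[ -> is_derive x 1 f 0} ->
  forall x, x \in `[a, b] -> f x = f a.
Proof.
move=> /lip_ge0[K K0 Kf] f0 x xI; have := xI; rewrite in_itv/= => /andP[ax xb].
have Kfx : forall y z, y \in `[a, x] -> z \in `[a, x] -> `|f y - f z| <= K * `|y - z|.
  by move=> y z; rewrite !in_itv/= => /andP[ay yx] /andP[az zx]; apply: Kf;
    rewrite in_itv/= ?ay ?az/= (le_trans _ xb).
apply/eqP; rewrite -subr_eq0 -normr_le0 leNgt; apply/negP => fx0.
(* Makes the bound e (x - a + K) less than half of the supposed positive difference; the summand 1
   keeps the denominator positive. *)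
pose e := `|f x - f a| / (2 * (x - a + K + 1)).
have c0 : 0 < x - a + K + 1 by lra.
have e0 : 0 < e by rewrite divr_gt0// mulr_gt0.
have := lip_derive0_bound ax K0 e0 Kfx (ae_subset_itv xI f0).
rewrite [K * e]mulrC -mulrDr => H.
have : e * (x - a + K + 1) = `|f x - f a| / 2.
  by rewrite /e invfM mulrA mulfVK// gt_eqF.
rewrite mulrDr mulr1 => H2; lra.
Qed.

End RealAnalysis.

(** * Integrals of essentially bounded functions *)

Section IndefiniteIntegral.
Variables (R : realType) (T : R).
Local Notation mu := (@lebesgue_measure R).
Implicit Types (f g : R -> R) (a b x y : R).

Lemma ae_imply (P Q : R -> Prop) : (forall x, P x -> Q x) ->
  {ae mu, forall x, P x} -> {ae mu, forall x, Q x}.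
Proof. by move=> PQ; apply: filterS; first exact: (ae_filter_ringOfSetsType mu). Qed.

Lemma ae_and (P Q : R -> Prop) :
  {ae mu, forall x, P x} -> {ae mu, forall x, Q x} -> {ae mu, forall x, P x /\ Q x}.
Proof. by move=> p q; apply: filterI => //; exact: (ae_filter_ringOfSetsType mu). Qed.

Lemma ae_forall_countable (I : countType) (P : I -> R -> Prop) :
  (forall i, {ae mu, forall x, P i x}) -> {ae mu, forall x, forall i, P i x}.
Proof.
move=> H; have : {ae mu, forall x, forall n,
    (fun n x => forall i, pickle i = n -> P i x) n x}.
  apply: ae_foralln => n; case E : (@pickle_inv I n) => [i|].
    apply: ae_imply (H i) => x Px j jn; move: E; rewrite -jn pickleK_inv.
    by case=> ->.
  by apply: aeW => x i iN; move: E; rewrite -iN pickleK_inv.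
by apply: ae_imply => x Px i; exact: (Px (pickle i)).
Qed.

Lemma is_derive_eq_itv a b f g x d : x \in `]a, b[ ->
  (forall y, y \in `]a, b[ -> f y = g y) -> is_derive x 1 f d -> is_derive x 1 g d.
Proof.
move=> xab fg fd.
have N : {near x, f =1 g}.
  have : \forall y \near x, y \in `]a, b[ by apply: near_in_itvoo.
  by apply: filterS => y; exact: fg.
apply: DeriveDef; first exact: near_eq_derivable N (@ex_derive _ _ _ _ _ _ _ fd).
by rewrite -(near_eq_derive (1 : R) N); exact: (@derive_val _ _ _ _ _ _ _ fd).
Qed.

Definition ae_bounded f := measurable_fun `[0, T] f /\
  exists M : R, {ae mu, forall x, x \in `[0, T] -> `|f x| <= M}.

Lemma ae_boundedP f : ae_bounded f -> measurable_fun `[0, T] f /\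
  exists2 M : R, 0 <= M & {ae mu, forall x, x \in `[0, T] -> `|f x| <= M}.
Proof.
move=> [mf [M fM]]; split => //; exists `|M| => //; apply: ae_imply fM => x fM xI.
by apply: (le_trans (fM xI)); exact: ler_norm.
Qed.

Lemma ae_bounded_integrable f : ae_bounded f -> mu.-integrable `[0, T] (EFin \o f).
Proof.
move=> /ae_boundedP[mf [M M0 fM]]; apply/integrableP; split; first exact/measurable_EFinP.
apply: (@le_lt_trans _ _ (M%:E * mu `[0%R, T])%E).
  apply: integral_le_bound => //; exact/measurable_EFinP.
rewrite lebesgue_measure_itv/= lte_fin; case: ifP => _; last by rewrite mule0 ltry.
by rewrite -EFinB -EFinM ltry.
Qed.

Lemma ae_bounded_integrableS f (A : set R) : measurable A -> A `<=` `[0, T] ->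
  ae_bounded f -> mu.-integrable A (EFin \o f).
Proof. by move=> mA AT fb; apply: integrableS (ae_bounded_integrable fb). Qed.

Lemma integral_norm_bound f M x y : 0 <= M -> 0 <= x -> x <= y -> y <= T ->
  ae_bounded f -> {ae mu, forall x, x \in `[0, T] -> `|f x| <= M} ->
  `|\int[mu]_(s in `]x, y]) f s| <= M * (y - x).
Proof.
move=> M0 x0 xy yT fb fM.
have sub : `]x, y] `<=` `[0, T].
  by move=> z /=; rewrite !in_itv/= => /andP[xz zy]; rewrite (le_trans x0 (ltW xz)) (le_trans zy).
have fi : mu.-integrable `]x, y] (EFin \o f) by exact: ae_bounded_integrableS.
rewrite -lee_fin EFin_normr_Rintegral//; apply: (le_trans (le_abse_integral _ _ _)) => //.
  by case/integrableP : fi.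
apply: (@le_trans _ _ (M%:E * mu `]x, y])%E).
  apply: integral_le_bound => //; first by case/integrableP : fi.
  have : {ae mu, forall z : R, `]x, y]%classic z -> (`|(EFin \o f) z| <= M%:E)%E}.
    by apply: ae_imply fM => z fM /= /sub zI; rewrite lee_fin fM.
  exact.
rewrite lebesgue_measure_itv/= lte_fin; case: ltP => [_|yx].
  by rewrite -EFinB -EFinM.
by rewrite mule0 lee_fin mulr_ge0// subr_ge0.
Qed.

Lemma integral_itvB f x y : 0 <= x -> x <= y -> y <= T -> ae_bounded f ->
  \int[mu]_(s in `[0, y]) f s - \int[mu]_(s in `[0, x]) f s = \int[mu]_(s in `]x, y]) f s.
Proof.
move=> x0 xy yT fb; rewrite Rintegral_itvB//.
apply: ae_bounded_integrableS => // z /=; rewrite !in_itv/= => /andP[-> zy].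
exact: le_trans yT.
Qed.

Lemma lip_integral f : ae_bounded f -> lip 0 T (fun x => \int[mu]_(s in `[0, x]) f s).
Proof.
move=> fb; have [_ [M M0 fM]] := ae_boundedP fb; exists M => x y.
wlog xy : x y / y <= x => [H xI yI|].
  have [yx|/ltW xy] := leP y x; first exact: H.
  by rewrite distrC (distrC x); exact: H.
rewrite !in_itv/= => /andP[x0 xT] /andP[y0 yT].
by rewrite integral_itvB// (@ger0_norm _ (x - y)) ?subr_ge0//; exact: integral_norm_bound.
Qed.

Lemma integral_itv_rev f x : x \in `[0, T] -> ae_bounded f ->
  \int[mu]_(s in `[x, T]) f s =
  \int[mu]_(s in `[0, T]) f s - \int[mu]_(s in `[0, x]) f s.
Proof.
rewrite in_itv/= => /andP[x0 xT] fb; rewrite integral_itvB// Rintegral_itv_obnd_cbnd//.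
apply: ae_bounded_integrableS => // z /=; rewrite !in_itv/= => /andP[xz ->].
by rewrite (le_trans x0 (ltW xz)).
Qed.

Lemma is_derive_integral f : ae_bounded f -> {ae mu, forall x, x \in `]0, T[ ->
  is_derive x 1 (fun x => \int[mu]_(s in `[0, x]) f s) (f x)}.
Proof.
(* Lebesgue differentiation is applied to the extension of f by 0, integrable on the whole line; the
   two functions have the same integrals inside the interval. *)
move=> fb; have fi := ae_bounded_integrable fb; set g := f \_ `[0, T].
have gi : mu.-integrable setT (EFin \o g).
  have := (@integrable_mkcond _ _ _ mu `[0, T] (EFin \o f) (measurable_itv _)).1 fi.
  by rewrite restrict_EFin.
have gl : locally_integrable setT g by exact: integrable_locally.
have := @FTC1 R g (BLeft 0) _ gl; have gy y : mu.-integrable `[0, y] (EFin \o g).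
  exact: integrableS gi.
move=> /(_ gy); apply: ae_imply => x xP xI; move: (xI); rewrite in_itv/= => /andP[x0 xT].
have [dG Gx] := xP x0; have gx : g x = f x.
  by rewrite /g patchE mem_set//= in_itv/= !ltW.
rewrite gx derive1E in Gx.
apply: (@is_derive_eq_itv 0 T (fun y => \int[mu]_(t in `[0, y]) g t)) => //.
  move=> y; rewrite in_itv/= => /andP[y0 yT]; apply: eq_Rintegral => z.
  rewrite inE/= in_itv/= => /andP[z0 zy]; rewrite /g patchE mem_set//= in_itv/= z0.
  exact: le_trans (ltW yT).

Qed.

Lemma ae_boundedM f g : ae_bounded f -> ae_bounded g -> ae_bounded (fun x => f x * g x).
Proof.
move=> /ae_boundedP[mf [M M0 fM]] /ae_boundedP[mg [N N0 gN]]; split.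
  exact: measurable_funM.
exists (M * N); apply: ae_imply (ae_and fM gN) => x [fx gx] xI.
by rewrite normrM ler_pM ?fx ?gx.
Qed.

Lemma ae_boundedB f g : ae_bounded f -> ae_bounded g -> ae_bounded (fun x => f x - g x).
Proof.
move=> [mf [M fM]] [mg [N gN]]; split; first exact: measurable_funB.
exists (M + N); apply: ae_imply (ae_and fM gN) => x [fx gx] xI.
by rewrite (le_trans (ler_normB _ _))// lerD ?fx ?gx.
Qed.

Lemma ae_boundedD f g : ae_bounded f -> ae_bounded g -> ae_bounded (fun x => f x + g x).
Proof.
move=> [mf [M fM]] [mg [N gN]]; split; first exact: measurable_funD.
exists (M + N); apply: ae_imply (ae_and fM gN) => x [fx gx] xI.
by rewrite (le_trans (ler_normD _ _))// lerD ?fx ?gx.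
Qed.

Lemma lip_bounded a b f : lip a b f ->
  exists2 M : R, 0 <= M & forall x, x \in `[a, b] -> `|f x| <= M.
Proof.
move=> /lip_ge0[K K0 Kf]; exists (K * `|b - a| + `|f a|).
  by rewrite addr_ge0// mulr_ge0.
move=> x xI; have := xI; rewrite in_itv/= => /andP[ax xb].
have aI : a \in `[a, b] by rewrite in_itv/= lexx (le_trans ax xb).
rewrite -[f x](subrK (f a)); apply: (le_trans (ler_normD _ _)).
rewrite lerD2r; apply: (le_trans (Kf x a xI aI)); rewrite ler_wpM2l// !ger0_norm ?lerD2r//.
  by rewrite subr_ge0 (le_trans ax).
by rewrite subr_ge0.
Qed.

Lemma lip_within_continuous a b f : lip a b f -> {within `[a, b], continuous f}.
Proof.
move=> /lip_ge0[K K0 Kf]; apply/subspace_continuousP => x xI.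
apply/cvgrPdist_le => e e0.
have K1 : 0 < K + 1 by rewrite ltr_wpDl.
have : \forall y \near x, `|x - y| <= e / (K + 1).
  by apply: (@cvgr_dist_le _ _ _ (nbhs x) _ id x) => //; rewrite divr_gt0.
rewrite near_withinE; apply: filterS => y xy yI; apply: (le_trans (Kf x y xI yI)).
apply: (@le_trans _ _ (K * (e / (K + 1)))); first exact: ler_wpM2l.
by rewrite mulrCA ler_piMr ?ltW// ltr_pdivrMr// mul1r ltrDl.
Qed.

Lemma lip_ae_bounded f : lip 0 T f -> ae_bounded f.
Proof.
move=> fl; split; last first.
  by have [M _ fM] := lip_bounded fl; exists M; apply: aeW.
by apply: subspace_continuous_measurable_fun => //; exact: lip_within_continuous.
Qed.

End IndefiniteIntegral.

(** * Arithmetic of Lipschitz functions *)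

Section Lipschitz.
Variables (R : realType) (a b : R).
Implicit Types f g : R -> R.

Lemma lip_cst (c : R) : lip a b (fun=> c).
Proof. by exists 0 => x y _ _; rewrite subrr normr0 mul0r. Qed.

Lemma lip_id : lip a b id.
Proof. by exists 1 => x y _ _; rewrite mul1r. Qed.

Lemma lipD f g : lip a b f -> lip a b g -> lip a b (fun x => f x + g x).
Proof.
move=> [K fK] [L gL]; exists (K + L) => x y xI yI; rewrite mulrDl opprD addrACA.
by rewrite (le_trans (ler_normD _ _))// lerD ?fK ?gL.
Qed.

Lemma lipN f : lip a b f -> lip a b (fun x => - f x).
Proof. by move=> [K fK]; exists K => x y xI yI; rewrite -opprD normrN fK. Qed.

Lemma lipB f g : lip a b f -> lip a b g -> lip a b (fun x => f x - g x).
Proof. by move=> fl gl; apply: lipD => //; exact: lipN. Qed.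

Lemma lipM f g : lip a b f -> lip a b g -> lip a b (fun x => f x * g x).
Proof.
move=> fl gl; have [M M0 fM] := lip_bounded fl; have [N N0 gN] := lip_bounded gl.
have [K K0 fK] := lip_ge0 fl; have [L L0 gL] := lip_ge0 gl.
exists (M * L + K * N) => x y xI yI.
have -> : f x * g x - f y * g y = f x * (g x - g y) + (f x - f y) * g y by ring.
apply: (le_trans (ler_normD _ _)); rewrite !normrM mulrDl -[M * L * _]mulrA.
by rewrite [K * N * _]mulrAC lerD// ler_pM ?fM ?gN ?fK ?gL// mulr_ge0.
Qed.

End Lipschitz.

(** * Complex-valued functions *)

Section ComplexCalculus.
Variable R : realType.
Local Notation mu := (@lebesgue_measure R).
Local Notation Re := complex.Re.
Local Notation Im := complex.Im.
Local Notation normc := Normc.normc.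
Implicit Types (f g : R -> R[i]) (a b x : R) (z d e : R[i]).

Lemma ReD z e : Re (z + e) = Re z + Re e. Proof. by case: z; case: e. Qed.
Lemma ImD z e : Im (z + e) = Im z + Im e. Proof. by case: z; case: e. Qed.
Lemma ReN z : Re (- z) = - Re z. Proof. by case: z. Qed.
Lemma ImN z : Im (- z) = - Im z. Proof. by case: z. Qed.
Lemma ReM z e : Re (z * e) = Re z * Re e - Im z * Im e.
Proof. by case: z; case: e. Qed.
Lemma ImM z e : Im (z * e) = Re z * Im e + Im z * Re e.
Proof. by case: z; case: e. Qed.
Lemma complex_eqP z e : Re z = Re e -> Im z = Im e -> z = e.
Proof. by case: z; case: e => ? ? ? ? /= -> ->. Qed.

Lemma normc_Re z : `|Re z| <= normc z.
Proof.
case: z => p q; rewrite /= -sqrtr_sqr ler_wsqrtr// lerDl; exact: sqr_ge0.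
Qed.

Lemma normc_Im z : `|Im z| <= normc z.
Proof.
case: z => p q; rewrite /= -sqrtr_sqr ler_wsqrtr// lerDr; exact: sqr_ge0.
Qed.

Lemma normc_le z : normc z <= `|Re z| + `|Im z|.
Proof.
case: z => p q /=; rewrite -[leRHS]ger0_norm ?addr_ge0// -sqrtr_sqr ler_wsqrtr//.
rewrite sqrrD !real_normK ?num_real// lerD2r lerDl mulrn_wge0// mulr_ge0//.
Qed.

Definition clip a b f := exists K : R, forall x y,
  x \in `[a, b] -> y \in `[a, b] -> normc (f x - f y) <= K * `|x - y|.

Lemma clipP a b f :
  clip a b f <-> lip a b (fun x => Re (f x)) /\ lip a b (fun x => Im (f x)).
Proof.
split=> [[K fK]|[[K fK] [L gL]]].
  split; exists K => x y xI yI; apply: le_trans (fK x y xI yI).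
    by rewrite -ReN -ReD normc_Re.
  by rewrite -ImN -ImD normc_Im.
exists (K + L) => x y xI yI; apply: (le_trans (normc_le _)).
by rewrite ReD ImD ReN ImN mulrDl lerD ?fK ?gL.
Qed.

Lemma clip_cst a b z : clip a b (fun=> z).
Proof. by apply/clipP; split; exact: lip_cst. Qed.

Lemma clipD a b f g : clip a b f -> clip a b g -> clip a b (fun x => f x + g x).
Proof.
move=> /clipP[f1 f2] /clipP[g1 g2]; apply/clipP; split.
  by under eq_fun do rewrite ReD; exact: lipD.
by under eq_fun do rewrite ImD; exact: lipD.
Qed.

Lemma clipM a b f g : clip a b f -> clip a b g -> clip a b (fun x => f x * g x).
Proof.
move=> /clipP[f1 f2] /clipP[g1 g2]; apply/clipP; split.
  by under eq_fun do rewrite ReM; apply: lipB; exact: lipM.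
by under eq_fun do rewrite ImM; apply: lipD; exact: lipM.
Qed.

Lemma clipZ a b z f : clip a b f -> clip a b (fun x => z * f x).
Proof. by move=> fl; apply: clipM => //; exact: clip_cst. Qed.

Lemma clipB a b f g : clip a b f -> clip a b g -> clip a b (fun x => f x - g x).
Proof.
move=> fl gl; have -> : (fun x => f x - g x) = (fun x => f x + (-1) * g x).
  by apply/funext => x; rewrite mulN1r.
by apply: clipD => //; exact: clipZ.
Qed.

Lemma clip_sum a b (I : Type) (r : seq I) (P : pred I) (F : I -> R -> R[i]) :
  (forall i, P i -> clip a b (F i)) -> clip a b (fun x => \sum_(i <- r | P i) F i x).
Proof.
move=> Fl; elim: r => [|i r IH].
  by under eq_fun do rewrite big_nil; exact: clip_cst.
have [Pi|Pi] := boolP (P i).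
  by under eq_fun do rewrite big_cons Pi; apply: clipD => //; exact: Fl.
by under eq_fun do rewrite big_cons (negbTE Pi).
Qed.

Lemma clipX a b f n : clip a b f -> clip a b (fun x => f x ^+ n).
Proof.
move=> fl; elim: n => [|n IH]; first by under eq_fun do rewrite expr0; exact: clip_cst.
by under eq_fun do rewrite exprS; exact: clipM.
Qed.

Lemma clipS a b a' b' f : a <= a' -> b' <= b -> clip a b f -> clip a' b' f.
Proof.
move=> aa bb [K fK]; exists K => x y; rewrite !in_itv/= => /andP[a1 b1] /andP[a2 b2].
by apply: fK; rewrite in_itv/= ?(le_trans aa a1) ?(le_trans aa a2)/=; exact: le_trans bb.
Qed.

(** Taken through real and imaginary parts to match the form of the equation in [path_solution]. *)
Definition cderiv f x d :=
  is_derive x 1 (fun s => Re (f s)) (Re d) /\ is_derive x 1 (fun s => Im (f s)) (Im d).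

Lemma cderiv_cst z x : cderiv (fun=> z) x 0.
Proof. by split; exact: is_derive_cst. Qed.

Lemma cderivD f g x d e : cderiv f x d -> cderiv g x e ->
  cderiv (fun s => f s + g s) x (d + e).
Proof.
move=> [f1 f2] [g1 g2]; rewrite /cderiv ReD ImD; split.
  by under eq_fun do rewrite ReD; exact: is_deriveD.
by under eq_fun do rewrite ImD; exact: is_deriveD.
Qed.

Lemma cderivM f g x d e : cderiv f x d -> cderiv g x e ->
  cderiv (fun s => f s * g s) x (d * g x + f x * e).
Proof.
move=> [f1 f2] [g1 g2]; rewrite /cderiv ReD ImD !ReM !ImM; split.
  under eq_fun do rewrite ReM.
  have := is_deriveB (is_deriveM f1 g1) (is_deriveM f2 g2).
  move=> H; apply: (is_derive_eq H); rewrite /GRing.scale/=; ring.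
under eq_fun do rewrite ImM.
have := is_deriveD (is_deriveM f1 g2) (is_deriveM f2 g1).
move=> H; apply: (is_derive_eq H); rewrite /GRing.scale/=; ring.
Qed.

Lemma cderivZ z f x d : cderiv f x d -> cderiv (fun s => z * f s) x (z * d).
Proof. by move=> fd; have := cderivM (cderiv_cst z x) fd; rewrite mul0r add0r. Qed.

Lemma cderivB f g x d e : cderiv f x d -> cderiv g x e ->
  cderiv (fun s => f s - g s) x (d - e).
Proof.
move=> fd ge; have := cderivD fd (cderivZ (-1) ge); rewrite mulN1r.
by under eq_fun do rewrite mulN1r.
Qed.

Lemma cderiv_sum x (I : Type) (r : seq I) (P : pred I) (F : I -> R -> R[i])
    (D : I -> R[i]) : (forall i, P i -> cderiv (F i) x (D i)) ->
  cderiv (fun s => \sum_(i <- r | P i) F i s) x (\sum_(i <- r | P i) D i).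
Proof.
move=> Fl; elim: r => [|i r IH].
  by under eq_fun do rewrite big_nil; rewrite big_nil; exact: cderiv_cst.
rewrite big_cons; have [Pi|Pi] := boolP (P i).
  by under eq_fun do rewrite big_cons Pi; apply: cderivD => //; exact: Fl.
by under eq_fun do rewrite big_cons (negbTE Pi).
Qed.

Lemma cderivX f x d n : cderiv f x d ->
  cderiv (fun s => f s ^+ n.+1) x (n.+1%:R * d * f x ^+ n).
Proof.
move=> fd; elim: n => [|n IH].
  by under eq_fun do rewrite expr1; rewrite expr0 mulr1 mul1r.
under eq_fun do rewrite exprS; have := cderivM fd IH.
congr cderiv; rewrite -[n.+2%:R]natr1 [f x ^+ n.+1]exprS; ring.
Qed.

Lemma cderiv_eq_itv a b f g x d : x \in `]a, b[ ->
  (forall y, y \in `]a, b[ -> f y = g y) -> cderiv f x d -> cderiv g x d.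
Proof.
move=> xI fg [f1 f2]; split.
  by apply: (is_derive_eq_itv xI _ f1) => y yI; rewrite fg.
by apply: (is_derive_eq_itv xI _ f2) => y yI; rewrite fg.
Qed.

Lemma clip_cderiv0_cst a b f : clip a b f ->
  {ae mu, forall x, x \in `]a, b[ -> cderiv f x 0} ->
  forall x, x \in `[a, b] -> f x = f a.
Proof.
move=> /clipP[f1 f2] fd x xI; apply: complex_eqP.
  apply: (lip_derive0_cst f1) => //.
  by apply: ae_imply fd => y yP /yP [].
apply: (lip_derive0_cst f2) => //.
by apply: ae_imply fd => y yP /yP [].
Qed.

Section Linfty.
Variable T : R.

Lemma LinftyP f : Linfty T f <->
  ae_bounded T (fun x => Re (f x)) /\ ae_bounded T (fun x => Im (f x)).
Proof.
split=> [[m1 m2 [M fM]]|[[m1 [M fM]] [m2 [N fN]]]].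
  split; split => //; exists M; apply: ae_imply fM => x fM xI;
    apply: le_trans (fM xI); [exact: normc_Re|exact: normc_Im].
split => //; exists (M + N); apply: ae_imply (ae_and fM fN) => x [fx gx] xI.
by apply: (le_trans (normc_le _)); rewrite lerD ?fx ?gx.
Qed.

Lemma LinftyM f g : Linfty T f -> Linfty T g -> Linfty T (fun x => f x * g x).
Proof.
move=> /LinftyP[f1 f2] /LinftyP[g1 g2]; apply/LinftyP; split.
  by under eq_fun do rewrite ReM; apply: ae_boundedB; exact: ae_boundedM.
by under eq_fun do rewrite ImM; apply: ae_boundedD; exact: ae_boundedM.
Qed.

Lemma clip_Linfty f : clip 0 T f -> Linfty T f.
Proof. by move=> /clipP[f1 f2]; apply/LinftyP; split; exact: lip_ae_bounded. Qed.

Lemma clip_cintegral f : Linfty T f -> clip 0 T (fun x => cintegral `[0, x] f).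
Proof.
by move=> /LinftyP[f1 f2]; apply/clipP; split; [exact: (lip_integral f1)|
  exact: (lip_integral f2)].
Qed.

Lemma cderiv_cintegral f : Linfty T f -> {ae mu, forall x, x \in `]0, T[ ->
  cderiv (fun x => cintegral `[0, x] f) x (f x)}.
Proof.
move=> /LinftyP[/is_derive_integral f1 /is_derive_integral f2].
by apply: ae_imply (ae_and f1 f2) => x [fx gx] xI; split; [exact: fx|exact: gx].
Qed.

Lemma cintegral_rev f x : x \in `[0, T] -> Linfty T f ->
  cintegral `[x, T] f = cintegral `[0, T] f - cintegral `[0, x] f.
Proof.
move=> xI /LinftyP[f1 f2]; rewrite /cintegral.
by rewrite (integral_itv_rev xI f1) (integral_itv_rev xI f2).
Qed.

Lemma cintegral_set1 f x : cintegral `[x, x] f = 0.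
Proof. by rewrite /cintegral set_itv1 !Rintegral_set1. Qed.

End Linfty.

End ComplexCalculus.

(** * Paths *)

Section Paths.
Variable R : realType.
Local Notation mu := (@lebesgue_measure R).
Local Notation normc := Normc.normc.
Implicit Types (F G Z A D E : R -> ncseries R) (a : posnat -> R -> R[i]) (x y s : R)
  (w v : word) (i j : posnat).

Definition nclip (p q : R) F := forall w, clip p q (fun x => F x w).

Definition ncderiv F x (D : ncseries R) := forall w, cderiv (fun s => F s w) x (D w).

Lemma nclipB p q F G : nclip p q F -> nclip p q G -> nclip p q (fun x => F x - G x).
Proof. by move=> Fl Gl w; exact: (clipB (Fl w) (Gl w)). Qed.

Lemma nclipM p q F G : nclip p q F -> nclip p q G -> nclip p q (fun x => F x * G x).
Proof. by move=> Fl Gl w; apply: clip_sum => k _; exact: (clipM (Fl _) (Gl _)). Qed.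

Lemma nclip_cst p q f : nclip p q (fun=> f).
Proof. by move=> w; exact: clip_cst. Qed.

Lemma nclip_wder p q F : nclip p q F -> nclip p q (fun x => wder (F x)).
Proof. by move=> Fl w; exact: (clipZ _ (Fl w)). Qed.

Lemma nclip_dynkin_op p q F : nclip p q F -> nclip p q (fun x => dynkin_op (F x)).
Proof.
move=> Fl w; elim/word_ind_dynkin: w F Fl => [|i|i v v0 IH1 IH2] F Fl.
- exact: clip_cst.
- exact: (clipZ _ (Fl _)).
- under eq_fun do rewrite dynkin_cons//.
  apply: clipB; first by apply: (IH1 (fun x => lder i (F x))) => w; exact: Fl.
  by apply: (IH2 (fun x => lder (last i v) (F x))) => w; exact: Fl.
Qed.

Lemma nclipS p q p' q' F : p <= p' -> q' <= q -> nclip p q F -> nclip p' q' F.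
Proof. by move=> pp qq Fl w; exact: clipS (Fl w). Qed.

Lemma ncderivB F G x d e : ncderiv F x d -> ncderiv G x e ->
  ncderiv (fun s => F s - G s) x (d - e).
Proof. by move=> Fd Gd w; exact: (cderivB (Fd w) (Gd w)). Qed.

Lemma ncderiv_cst f x : ncderiv (fun=> f) x 0.
Proof. by move=> w; exact: cderiv_cst. Qed.

Lemma ncderivM F G x d e : ncderiv F x d -> ncderiv G x e ->
  ncderiv (fun s => F s * G s) x (d * G x + F x * e).
Proof.
move=> Fd Gd w; rewrite ncD !ncM -big_split/=.
by apply: cderiv_sum => k _; exact: (cderivM (Fd _) (Gd _)).
Qed.

Lemma ncderiv_wder F x d : ncderiv F x d -> ncderiv (fun s => wder (F s)) x (wder d).
Proof. by move=> Fd w; exact: (cderivZ _ (Fd w)). Qed.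

Lemma ncderiv_dynkin_op F x d : ncderiv F x d ->
  ncderiv (fun s => dynkin_op (F s)) x (dynkin_op d).
Proof.
move=> Fd w; elim/word_ind_dynkin: w F d Fd => [|i|i v v0 IH1 IH2] F d Fd.
- exact: cderiv_cst.
- exact: (cderivZ _ (Fd _)).
- rewrite dynkin_cons//; under eq_fun do rewrite dynkin_cons//.
  apply: cderivB; first by apply: (IH1 (fun x => lder i (F x))) => w; exact: Fd.
  by apply: (IH2 (fun x => lder (last i v) (F x))) => w; exact: Fd.
Qed.

Lemma nclip_ncderiv0_cst p q F : nclip p q F ->
  {ae mu, forall x, x \in `]p, q[ -> ncderiv F x 0} ->
  forall x, x \in `[p, q] -> F x = F p.
Proof.
move=> Fl Fd x xI; apply/funext => w.
apply: (clip_cderiv0_cst (Fl w)) => //.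
by apply: ae_imply Fd => y yP /yP.
Qed.

(** The coefficient of A Z at i :: w is that of A at i times that of Z at w, which vanishes by
    induction on the word. So each coefficient of Z has derivative 0 almost everywhere and keeps its
    initial value 0. *)
Lemma ode_zero p q A Z : nclip p q Z -> (forall x, letters (A x)) ->
  {ae mu, forall x, x \in `]p, q[ -> ncderiv Z x (A x * Z x)} ->
  Z p = 0 -> forall x, x \in `[p, q] -> Z x = 0.
Proof.
move=> Zl Al Zd Zp x xI; apply/funext => w; rewrite nc0; elim: w x xI => [|i w IH] x xI.
  rewrite (clip_cderiv0_cst (Zl [::]) _ xI) ?Zp//.
  apply: ae_imply Zd => y yP /yP /(_ [::]).
  by rewrite ncM_nil letters_nil// mul0r.
rewrite (clip_cderiv0_cst (Zl (i :: w)) _ xI) ?Zp//.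
apply: ae_imply Zd => y yP yI; have := yP yI (i :: w).
rewrite lettersM_cons// IH ?mulr0//; apply: subset_itv_oo_cc; exact: yI.
Qed.

Lemma letters_path_symbol a x : letters (path_symbol a x).
Proof. by case=> [|i [|j w]]. Qed.

Section OnInterval.
Variable T : R.
Hypothesis T_gt0 : 0 < T.

Lemma inTT : T \in `[0, T]. Proof. by rewrite in_itv/= lexx ltW. Qed.

Lemma path_solutionP a F : path_solution T a F <->
  [/\ forall x, x \in `[0, T] -> group_G (F x), F 0 = 1, nclip 0 T F &
      {ae mu, forall x, x \in `]0, T[ -> ncderiv F x (path_symbol a x * F x)}].
Proof. by split=> -[]. Qed.

(** Z = N F - D(F) F satisfies Z' = A Z: as F has constant term 1, [dynkin_lettersM] gives D(A F) =
    N A + [A, D(F)]. The terms (N A) F cancel between the two parts of Z', and the two occurrences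
    of D(F) A F cancel within the second. *)
Lemma path_solution_grouplike a F : path_solution T a F ->
  forall x, x \in `[0, T] -> grouplike (F x).
Proof.
move=> /path_solutionP[F1 F0 Fl Fd] x xI; split; first exact: F1.
apply/eqP; rewrite -subr_eq0; apply/eqP.
pose Z x := wder (F x) - dynkin_op (F x) * F x.
rewrite -[LHS]/(Z x); apply: (@ode_zero 0 T (path_symbol a)) => //.
- apply: nclipB; first exact: nclip_wder.
  by apply: nclipM => //; exact: nclip_dynkin_op.
- exact: letters_path_symbol.
- apply: ae_imply Fd => y yP yI; have Fy := yP yI.
  have Fy1 : F y [::] = 1 by apply: F1; apply: subset_itv_oo_cc.
  have := ncderivB (ncderiv_wder Fy) (ncderivM (ncderiv_dynkin_op Fy) Fy).
  congr ncderiv; set B := path_symbol a y; set f := F y in Fy1 *.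
  have BL : letters B by exact: letters_path_symbol.
  rewrite dynkin_lettersM// Fy1 scale1r wderM /Z /bracket -/f.
  rewrite !(mulrBr, mulrDl, mulrBl, mulrDr, mulNr) !mulrA.
  by apply/funext => w; rewrite !(ncB, ncD, ncN); ring.
- by rewrite /Z F0 wder1 dynkin_1 mul0r subrr.
Qed.

Lemma path_solution_unique a F G : path_solution T a F -> path_solution T a G ->
  forall x, x \in `[0, T] -> F x = G x.
Proof.
move=> /path_solutionP[_ F0 Fl Fd] /path_solutionP[_ G0 Gl Gd] x xI.
apply/eqP; rewrite -subr_eq0; apply/eqP.
apply: (@ode_zero 0 T (path_symbol a) (fun x => F x - G x)) => //.
- exact: nclipB.
- exact: letters_path_symbol.
- apply: ae_imply (ae_and Fd Gd) => y [yF yG] yI; rewrite mulrBr.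
  by apply: ncderivB; [exact: yF|exact: yG].
- by rewrite F0 G0 subrr.
Qed.

(** The Picard series read coefficientwise; the first letter is integrated last because A multiplies
    on the left. *)
Fixpoint path_flow_coef a w x : R[i] :=
  if w is i :: w' then cintegral `[0, x] (fun s => a i s * path_flow_coef a w' s) else 1.

Definition path_flow a x : ncseries R := fun w => path_flow_coef a w x.

Section Flow.
Variable a : posnat -> R -> R[i].
Hypothesis aX : path_space T a.

Lemma path_flow_clip : nclip 0 T (path_flow a).
Proof.
elim=> [|i w IH]; first exact: clip_cst.
apply: clip_cintegral; apply: LinftyM; last exact: clip_Linfty.
exact: aX.1.
Qed.

Lemma path_flow_solution : path_solution T a (path_flow a).
Proof.
apply/path_solutionP; split.
- by [].
- apply/funext => -[|i w]; rewrite nc1// /path_flow/=.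
  by rewrite cintegral_set1.
- exact: path_flow_clip.
(* The equation must hold for all words off a single null set, which countability of the set of
   words provides. *)
have H : {ae mu, forall x, forall w, x \in `]0, T[ ->
    cderiv (fun s => path_flow a s w) x ((path_symbol a x * path_flow a x) w)}.
  apply: ae_forall_countable => -[|i w].
    apply: aeW => x xI; rewrite ncM_nil letters_nil; last exact: letters_path_symbol.
    by rewrite mul0r; exact: cderiv_cst.
  apply: ae_imply (cderiv_cintegral _) => [x xP xI|].
    rewrite lettersM_cons; last exact: letters_path_symbol.
    exact: (xP xI).
  apply: LinftyM; first exact: aX.1.
  by apply: clip_Linfty; exact: path_flow_clip.
by apply: ae_imply H => x xP xI w; exact: xP.
Qed.

Lemma endpointE : endpoint T a = path_flow a T.
Proof.
rewrite /endpoint; apply: (path_solution_unique _ path_flow_solution inTT).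
by apply: (xgetPex (fun=> 1)); exists (path_flow a); exact: path_flow_solution.
Qed.

Lemma endpoint_grouplike : grouplike (endpoint T a).
Proof.
by rewrite endpointE; apply: (path_solution_grouplike path_flow_solution inTT).
Qed.

Lemma iterated_integral_from_clip w : clip 0 T (iterated_integral_from T a w).
Proof.
elim: w => [|i w IH]; first exact: clip_cst.
have H : Linfty T (fun s => a i s * iterated_integral_from T a w s).
  by apply: LinftyM; [exact: aX.1|exact: clip_Linfty].
have [K fK] := clipB (clip_cst 0 T (cintegral `[0, T]
  (fun s => a i s * iterated_integral_from T a w s))) (clip_cintegral H).
have E z : z \in `[0, T] -> iterated_integral_from T a (i :: w) z =
    cintegral `[0, T] (fun s => a i s * iterated_integral_from T a w s) -
    cintegral `[0, z] (fun s => a i s * iterated_integral_from T a w s).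
  by move=> zI; exact: cintegral_rev.
by exists K => x y xI yI; rewrite !E//; exact: fK.
Qed.

Lemma iterated_integral_from_cderiv : {ae mu, forall x, x \in `]0, T[ -> forall w i,
  cderiv (iterated_integral_from T a (i :: w)) x
    (- (a i x * iterated_integral_from T a w x))}.
Proof.
have H : {ae mu, forall x, forall w, x \in `]0, T[ ->
    if w is i :: w' then cderiv (iterated_integral_from T a (i :: w')) x
      (- (a i x * iterated_integral_from T a w' x)) else True}.
  apply: ae_forall_countable => -[|i w]; first by apply: aeW.
  have H : Linfty T (fun s => a i s * iterated_integral_from T a w s).
    apply: LinftyM; first exact: aX.1.
    by apply: clip_Linfty; exact: iterated_integral_from_clip.
  apply: ae_imply (cderiv_cintegral H) => x xP xI.
  have := cderivB (cderiv_cst (cintegral `[0, T]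
    (fun s => a i s * iterated_integral_from T a w s)) x) (xP xI).
  rewrite sub0r; apply: (cderiv_eq_itv xI) => y yI.
  apply/esym/cintegral_rev => //; exact: subset_itv_oo_cc.
by apply: ae_imply H => x xP xI w i; exact: (xP (i :: w) xI).
Qed.

(* The backward series Kr satisfies Kr' = - Kr A, so Kr F is constant. *)
Lemma endpoint_iterated_integral w : endpoint T a (rev w) = iterated_integral T a w.
Proof.
pose Kr x : ncseries R := fun w => iterated_integral_from T a (rev w) x.
have Kl : nclip 0 T Kr by move=> v; exact: iterated_integral_from_clip.
have Kd : {ae mu, forall x, x \in `]0, T[ -> ncderiv Kr x (- (Kr x * path_symbol a x))}.
  apply: ae_imply iterated_integral_from_cderiv => x xP xI; elim/last_ind => [|v i _].
    rewrite ncN ncM_nil (letters_nil (letters_path_symbol a x)) mulr0 oppr0.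
    exact: cderiv_cst.
  rewrite ncN lettersM_rcons; last exact: letters_path_symbol.
  rewrite /Kr rev_rcons mulrC; exact: xP.
have /path_solutionP[_ F0 Fl Fd] := path_flow_solution.
have KF : Kr T * path_flow a T = Kr 0 * path_flow a 0.
  apply: (@nclip_ncderiv0_cst 0 T (fun x => Kr x * path_flow a x)); last exact: inTT.
    exact: nclipM.
  apply: ae_imply (ae_and Kd Fd) => x [xK xF] xI.
  have := ncderivM (xK xI) (xF xI).
  by rewrite mulNr !mulrA addNr.
(* At T the integrals range over one point, so only the empty word survives; hence [path_flow a T]
   is [Kr 0]. *)
have KT : Kr T = 1.
  apply/funext => v; rewrite nc1 /Kr; have [->//|v0] := eqVneq v [::].
  have : rev v != [::] by rewrite -size_eq0 size_rev size_eq0.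
  by case: (rev v) => // i u _; rewrite /= cintegral_set1.
move: KF; rewrite KT F0 mul1r mulr1 endpointE => ->.
by rewrite /Kr revK.
Qed.

End Flow.

End OnInterval.

Lemma ncderiv_letter_exp (u : R -> R[i]) x (d : R[i]) i : cderiv u x d ->
  ncderiv (fun s => letter_exp (u s) i) x (d *: var R i * letter_exp (u x) i).
Proof.
move=> ud [|j w].
  under eq_fun do rewrite letter_exp_nil.
  by rewrite ncM_nil ncZ letters_nil ?mulr0 ?mul0r; [exact: cderiv_cst|exact: letters_var].
rewrite -scalerAl ncZ lettersM_cons; last exact: letters_var.
rewrite /letter_exp /= /var eqseq_cons andbT.
have [ji|ji] := eqVneq j i; last by rewrite /= mul0r mulr0; exact: cderiv_cst.
case: (all _ w); last by rewrite !mulr0; exact: cderiv_cst.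
have := cderivZ ((size w).+1`!%:R^-1) (cderivX (size w) ud).
congr cderiv; rewrite mul1r factS natrM invfM.
have F m : (m`!%:R : R[i]) != 0 by rewrite pnatr_eq0 -lt0n fact_gt0.
have S0 : ((size w).+1%:R : R[i]) != 0 by rewrite pnatr_eq0.
move: (F (size w)) S0; move: ((size w)`!%:R) ((size w).+1%:R) => p q p0 q0.
by field; rewrite p0 q0.
Qed.

Lemma nclip_letter_exp p q (u : R -> R[i]) i : clip p q u ->
  nclip p q (fun s => letter_exp (u s) i).
Proof.
move=> ul w; rewrite /letter_exp; case: (all _ w); last exact: clip_cst.
by apply: clipZ; exact: clipX.
Qed.

(** * Piecewise constant paths and density *)

Section Reachability.
Variable T : R.
Hypothesis T_gt0 : 0 < T.

Definition concat_path a s (c : R[i]) i : posnat -> R -> R[i] :=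
  fun j x => if x < s then a j x else if j == i then c else 0.

Lemma concat_path_space a s c i : path_space T a -> path_space T (concat_path a s c i).
Proof.
move=> [aL [M aM]].
have mlt : measurable_fun `[0, T] (fun x : R => x < s).
  apply: measurable_funS (_ : measurable_fun setT _) => //.
  exact: measurable_fun_ltr.
have mif (f : R -> R) (z : R) : measurable_fun `[0, T] f ->
    measurable_fun `[0, T] (fun x => if x < s then f x else z).
  move=> mf; apply: measurable_fun_if => //.
  by apply: measurable_funS mf => // x [].
split=> [j|].
  have [m1 m2 [K fK]] := aL j; pose z := if j == i then c else 0.
  split.
  - rewrite (_ : (fun x => _) = fun x => if x < s then complex.Re (a j x) else complex.Re z).
      exact: mif.
    by apply/funext => x; rewrite /concat_path; case: ifP.
  - rewrite (_ : (fun x => _) = fun x => if x < s then complex.Im (a j x) else complex.Im z).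
      exact: mif.
    by apply/funext => x; rewrite /concat_path; case: ifP.
  - exists (`|K| + normc z); apply: ae_imply fK => x fx xI; rewrite /concat_path.
    have z0 : 0 <= normc z by exact: le_trans (normr_ge0 _) (normc_Re z).
    case: ifP => _; last by rewrite -/z lerDr.
    by apply: (le_trans (fx xI)); apply: (le_trans (ler_norm K)); rewrite lerDl.
exists (`|M| + normc c `^ (i%:R)^-1); apply: ae_imply aM => x ax xI j; rewrite /concat_path.
case: ifP => _.
  apply: (le_trans (ax xI j)); apply: (le_trans (ler_norm M)).
  by rewrite lerDl powR_ge0.
case: eqP => [->|_]; first by rewrite lerDr.
rewrite (_ : normc 0 = 0); last by rewrite /= expr0n/= addr0 sqrtr0.
(* Positivity of the index matters here: 0 raised to the exponent 1/i is 0 only because the exponent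
   is nonzero. *)
rewrite powR0 ?addr_ge0 ?powR_ge0// invr_eq0 pnatr_eq0 -lt0n; exact: posnat_gt0.
Qed.

Lemma path_space0 : path_space T (fun _ _ => 0).
Proof.
split=> [i|].
  split; [exact: measurable_cst|exact: measurable_cst|].
  by exists 0; apply: aeW => x _; rewrite /= expr0n/= addr0 sqrtr0.
exists 1; apply: aeW => x _ i; rewrite /= expr0n/= addr0 sqrtr0.
by rewrite powR0// invr_eq0 pnatr_eq0 -lt0n; exact: posnat_gt0.
Qed.

Lemma path_flow0 x : path_flow (fun _ _ => 0) x = 1.
Proof.
apply/funext => -[|i w]; rewrite nc1// /path_flow/=.
under [X in cintegral _ X]eq_fun do rewrite mul0r.
by rewrite /cintegral /Rintegral/= !integral0.
Qed.

(** Uniqueness is applied twice: on [0, s] against the flow of a, then on [s, T] against exp((x - s)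
    c X_i) times the value at s. A later piece multiplies on the left. *)
Lemma path_flow_concat a s c i : path_space T a -> s \in `[0, T] ->
  forall x, x \in `[s, T] -> path_flow (concat_path a s c i) x =
    letter_exp ((x - s)%:C%C * c) i * path_flow a s.
Proof.
move=> aX sI x xI; have := sI; rewrite in_itv/= => /andP[s0 sT].
set a' := concat_path a s c i; have a'X : path_space T a' by exact: concat_path_space.
have /path_solutionP[_ F0 Fl Fd] := path_flow_solution aX.
have /path_solutionP[_ F0' Fl' Fd'] := path_flow_solution a'X.
have Es : path_flow a' s = path_flow a s.
  apply/eqP; rewrite -subr_eq0; apply/eqP.
  apply: (@ode_zero 0 s (path_symbol a) (fun x => path_flow a' x - path_flow a x)).
  - by apply: nclipB; [exact: nclipS Fl'|exact: nclipS Fl].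
  - exact: letters_path_symbol.
  - apply: ae_imply (ae_and Fd' Fd) => y [y1 y2]; rewrite in_itv/= => /andP[y0 ys].
    have yI : y \in `]0, T[ by rewrite in_itv/= y0 (lt_le_trans ys).
    have -> : path_symbol a y * (path_flow a' y - path_flow a y) =
        path_symbol a' y * path_flow a' y - path_symbol a y * path_flow a y.
      rewrite mulrBr; congr (_ * _ - _); apply/funext => -[|j [|k w]] //=.
      by rewrite /a' /concat_path ys.
    by apply: ncderivB; [exact: y1|exact: y2].
  - by rewrite F0 F0' subrr.
  - by rewrite in_itv/= s0 lexx.
apply/eqP; rewrite -subr_eq0; apply/eqP.
pose u (y : R) : R[i] := (y - s)%:C%C * c.
have ud y : cderiv u y c.
  have H : cderiv (fun y : R => (y - s)%:C%C) y 1.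
    split=> /=; last exact: is_derive_cst.
    have := is_deriveB (@is_derive_id _ _ y (1 : R)) (is_derive_cst s y (1 : R)).
    by rewrite subr0.
  by have := cderivM H (cderiv_cst c y); rewrite mul1r mulr0 addr0.
have ul : clip s T u.
  apply: clipM; last exact: clip_cst.
  apply/clipP; split; last exact: lip_cst.
  by apply: lipB; [exact: lip_id|exact: lip_cst].
apply: (@ode_zero s T (path_symbol a')
  (fun y => path_flow a' y - letter_exp (u y) i * path_flow a s)) => //.
- apply: nclipB; first exact: nclipS Fl'.
  by apply: nclipM; [exact: nclip_letter_exp|exact: nclip_cst].
- exact: letters_path_symbol.
- apply: ae_imply Fd' => y y1; rewrite in_itv/= => /andP[sy yT].
  have yI : y \in `]0, T[ by rewrite in_itv/= yT (le_lt_trans s0).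
  have E : path_symbol a' y = c *: var R i.
    apply/funext => -[|j [|k w]] //=; rewrite ncZ /var ?eqseq_cons ?andbF ?mulr0//.
    rewrite /a' /concat_path ltNge (ltW sy) /= andbT.
    by case: eqP => _; rewrite ?mulr1 ?mulr0.
  have := ncderivB (y1 yI) (ncderivM (ncderiv_letter_exp i (ud y))
    (ncderiv_cst (path_flow a s) y)).
  by rewrite mulr0 addr0 E mulrBr !mulrA.
- by rewrite /u subrr mul0r letter_exp0 mul1r Es subrr.
Qed.

Definition letter_exp_prod : set (ncseries R) :=
  [set g | exists r : seq (R[i] * posnat), g = \prod_(p <- r) letter_exp p.1 p.2].

(** Quantifying over the end time s lets the induction halve it: the remaining product is reached at
    s / 2, and the leftmost factor, traversed last, takes the second half. *)
Lemma letter_exp_prod_reachable g s : letter_exp_prod g -> 0 < s -> s <= T ->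
  exists2 a, path_space T a & path_flow a s = g.
Proof.
move=> [r ->]; elim: r s => [|[y i] r IH] s s0 sT.
  by exists (fun _ _ => 0); [exact: path_space0|rewrite path_flow0 big_nil].
have h0 : 0 < s / 2 by rewrite divr_gt0.
have hs : s / 2 <= s by lra.
have [a aX aE] := IH (s / 2) h0 (le_trans hs sT).
(* Speed y / (s / 2), so that a duration s / 2 produces exp(y X_i). *)
exists (concat_path a (s / 2) ((s / 2)^-1%:C%C * y) i).
  exact: concat_path_space.
rewrite path_flow_concat//.
- rewrite aE big_cons /=; congr (letter_exp _ _ * _).
  have -> : s - s / 2 = s / 2 by lra.
  by rewrite mulrA -rmorphM/= divff ?gt_eqF// mul1r.
- by rewrite in_itv/= (ltW h0) (le_trans hs).
- by rewrite in_itv/= hs sT.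
Qed.

Lemma letter_exp_prod_endpoint : letter_exp_prod `<=` endpoint T @` path_space T.
Proof.
move=> g gS; have [a aX aE] := letter_exp_prod_reachable gS T_gt0 (lexx T).
by exists a => //; rewrite endpointE.
Qed.

Lemma letter_exp_prodM g h :
  letter_exp_prod g -> letter_exp_prod h -> letter_exp_prod (g * h).
Proof. by move=> [r ->] [t ->]; exists (r ++ t); rewrite big_cat. Qed.

Lemma letter_exp_prod1 : letter_exp_prod 1.
Proof. by exists [::]; rewrite big_nil. Qed.

Lemma letter_exp_prod_letter (z : R[i]) i : letter_exp_prod (letter_exp z i).
Proof. by exists [:: (z, i)]; rewrite big_seq1. Qed.

Lemma letter_exp_prodV g : letter_exp_prod g ->
  exists2 h, letter_exp_prod h & g * h = 1 /\ h * g = 1.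
Proof.
move=> [r ->]; elim: r => [|[y i] r [h hS [E1 E2]]].
  by exists 1; [exact: letter_exp_prod1|rewrite big_nil mul1r].
exists (h * letter_exp (- y) i).
  by apply: letter_exp_prodM => //; exact: letter_exp_prod_letter.
rewrite big_cons /=; set p := \prod_(_ <- _) _ in E1 E2 *; split.
  by rewrite -!mulrA [p * _]mulrA E1 mul1r letter_expM subrr letter_exp0.
by rewrite -!mulrA [letter_exp (- y) i * _]mulrA letter_expM addNr letter_exp0 mul1r.
Qed.

Lemma formal_pathsE : formal_paths T = @grouplike R.
Proof.
have sub : endpoint T @` path_space T `<=` @grouplike R.
  by move=> _ [a aX <-]; exact: endpoint_grouplike.
rewrite eqEsubset; split; first exact: grouplike_closure.
move=> g gG; split; last by case: gG.
apply: closure_approx => n.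
have [h hS hg] := approx_grouplike letter_exp_prod1 letter_exp_prodM letter_exp_prodV
  (subset_trans letter_exp_prod_endpoint sub) letter_exp_prod_letter n gG.
by exists h => //; exact: letter_exp_prod_endpoint.
Qed.

End Reachability.

End Paths.

(** * Formal centers *)

Section FormalCenters.
Variables (R : realType) (T : R).
Hypothesis T_gt0 : 0 < T.
Implicit Types (f g : ncseries R) (w : word).

(** [Ihat] is obtained by choice, but endpoints are dense in the formal paths, so it agrees there
    with any continuous function having the same values on endpoints; the coefficient at the
    reversed word is one. *)
Lemma IhatE w g : formal_paths T g -> Ihat T w g = g (rev w).
Proof.
have coord : {within formal_paths T, continuous (fun h : ncseries R => h (rev w) : (R[i])^o)}.
  apply/subspace_continuousP => h _.
  have /cvg_ncseriesP H : within (formal_paths T) (nbhs h) --> h by exact: cvg_within.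
  exact: H.
pose extends (J : ncseries R -> (R[i])^o) := {within formal_paths T, continuous J} /\
  forall a, path_space T a -> J (endpoint T a) = iterated_integral T a w.
have [Jc JE] : extends (Ihat T w).
  apply: (@xgetPex _ (fun=> 0) extends).
  exists (fun h : ncseries R => h (rev w) : (R[i])^o); split => // a aX.
  exact: endpoint_iterated_integral.
apply: (@within_continuous_unique R (endpoint T @` path_space T)
  (formal_paths T) (Ihat T w) (fun h => h (rev w))) => //.
- move=> _ [a aX <-]; rewrite formal_pathsE//; exact: endpoint_grouplike.
- by move=> h [].
- by move=> _ [a aX <-]; rewrite JE// endpoint_iterated_integral.
Qed.

Lemma Phat_idP g : formal_paths T g ->
  Phat T g = (fun n => (n == 1)%:R) <->
  forall n, (0 < n)%N -> center_action 0 g n = 0.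
Proof.
move=> gF.
(* Degree i sits at r^(i+1); the coefficients of r^0 and r^1 are fixed by definition. *)
have E n : Phat T g n.+2 = center_action 0 g n.+1.
  rewrite center_actionE /Phat fsbig_words; apply: eq_bigr => w _.
  by rewrite IhatE.
split=> [H [//|n] _|H]; first by rewrite -E H.
by apply/funext => -[|[|n]] //; rewrite E H.
Qed.

(** The condition is put on f itself rather than on the coefficients of an expansion in nested
    brackets, which are not unique. *)
Definition center_lie : set (ncseries R) :=
  [set f | lie_elements f /\ forall n, (0 < n)%N -> center_action 0 f n = 0].

Lemma formal_centersE : formal_centers T = @nc_exp R @` center_lie.
Proof.
rewrite eqEsubset; split=> [g [gF] /(Phat_idP gF) gC|_ [f [fL fC] <-]].
  have gG : grouplike g by rewrite -(formal_pathsE T_gt0).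
  have f0 := logser_nil gG.1; have fE := logserK gG.1.
  exists (logser g); last by rewrite nc_expE.
  split; first by apply: lie_elements_of_grouplike; rewrite ?fE.
  by apply/(center_action_expser f0); rewrite fE.
have f0 : f [::] = 0 by case: fL.
have eG : formal_paths T (nc_exp f).
  by rewrite formal_pathsE// nc_expE//; exact: grouplike_expser.
split => //; apply/(Phat_idP eG); rewrite nc_expE//.
exact/(center_action_expser f0).
Qed.

Lemma log_formal_centers : @nc_log R @` formal_centers T = center_lie.
Proof.
have [_ inj _] := nc_exp_bij R.
have logK f : lie_elements f -> nc_log (nc_exp f) = f.
  by case=> f0 _; rewrite /nc_log pinvKV// inE.
rewrite formal_centersE eqEsubset; split=> [_ [_ [f fC <-] <-]|f fC].
  by rewrite logK//; case: fC.
by exists (nc_exp f); [exists f|rewrite logK//; case: fC].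
Qed.

(** When a product acts on r, its left factor acts first and already kills r; so the bracket of two
    elements killing r kills r. *)
Lemma lie_subalgebra_center_lie : lie_subalgebra center_lie.
Proof.
have [L0 LD LZ LB] := lie_subalgebra_lie_elements R; split.
- by split => // n _; exact: center_action0.
- move=> f g [fL fC] [gL gC]; split=> [|n n0]; first exact: LD.
  by rewrite center_actionD fC// gC// addr0.
- move=> a f [fL fC]; split=> [|n n0]; first exact: LZ.
  by rewrite center_actionZ fC// mulr0.
- move=> f g [fL fC] [gL gC]; split=> [|n n0]; first exact: LB.
  (* Extends the vanishing to degree 0, where the action is the constant term of h. *)
  have C0 h m : lie_elements h -> (forall n, (0 < n)%N -> center_action 0 h n = 0) ->
      center_action 0 h m = 0.
    move=> [h0 _] hC; have [->|m0] := posnP m; last exact: hC.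
    by rewrite center_action_at0.
  rewrite /bracket center_actionB !center_actionM !big1 ?subrr// => m _.
    by rewrite C0// mul0r.
  by rewrite C0// mul0r.
Qed.

Lemma center_lie_series (c : word -> R[i]) : center_lie (lie_series c) <->
  forall n, (0 < n)%N ->
    \sum_(w \in [set w | weight w = n]) c w * (gamma w)%:~R = 0.
Proof.
split=> [[_ H] n n0|H].
  by rewrite fsbig_words -center_action_lie_series// H.
split=> [|n n0]; first exact: lie_elements_lie_series.
by rewrite center_action_lie_series// -fsbig_words H.
Qed.

End FormalCenters.

Theorem mainTheorem5 (R : realType) (T : R) (T_gt0 : 0 < T) :
  let gamma_vanishes (c : word -> R[i]) := forall n : nat, (0 < n)%N ->
    \sum_(w \in [set w | weight w = n]) c w * (gamma w)%:~R = 0 in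
  let L := @nc_log R @` formal_centers T in
  [/\ L `<=` @lie_elements R,
      lie_subalgebra L,
      L = [set g | lie_elements g /\
             exists c : word -> R[i], g = lie_series c /\ gamma_vanishes c],
      forall c : word -> R[i], L (lie_series c) <-> gamma_vanishes c &
      homeomorphism_between L (formal_centers T) (@nc_exp R)].
Proof.
move=> gamma_vanishes L; rewrite {}/L log_formal_centers//; split.
- by move=> f [].
- exact: lie_subalgebra_center_lie.
- rewrite eqEsubset; split=> [g gC|g [gL [c [-> cC]]]]; last exact/center_lie_series.
  split; first by case: gC.
  have [c gE] := lie_element_lie_series gC.1.
  by exists c; split => //; apply/center_lie_series; rewrite -gE.
- by move=> c; exact: center_lie_series.
- by apply: nc_exp_homeomorphism; [move=> f [[]]|exact: formal_centersE].
Qed.
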